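(* Let $\Delta\mathfrak G$ be a planar crossed simplicial group, and let $A$ be a unital associative algebra over a field $\mathbf k$ with a twisted action of $\mathfrak G_0$. Then the collection of vector spaces $$C_\bullet(A)=\bigl\{C_n(A)=A^{\otimes(n+1)}\bigr\}_{n\ge0},$$ given by the terms of the Hochschild complex of $A$, naturally forms a $\Delta\mathfrak G$-vector space. In particular, the group $\mathfrak G_n$ acts on $C_n(A)$.
   Context: $\Delta$ is the simplex category (objects $[n]=\{0,\dots,n\}$, weakly monotone maps). A crossed simplicial group is a category $\Delta\mathfrak G$ with an embedding $\Delta\to\Delta\mathfrak G$, bijective on objects, such that every morphism $[m]\to[n]$ is uniquely $\phi\circ g$ with $\phi$ in $\Delta$ and $g\in\mathfrak G_m:=\mathrm{Aut}_{\Delta\mathfrak G}([m])$. For $\phi\in\mathrm{Hom}_\Delta([m],[n])$ and $g\in\mathfrak G_n$ there are unique $g^*\phi\in\mathrm{Hom}_\Delta([m],[n])$ and $\phi^*g\in\mathfrak G_m$ with $g\circ g^*\phi=\phi\circ\phi^*g$. A $\Delta\mathfrak G$-object of a category $\mathcal C$ is a functor $\Delta\mathfrak G^{op}\to\mathcal C$; a $\Delta\mathfrak G$-vector space is a $\Delta\mathfrak G$-object of the category of $\mathbf k$-vector spaces. Planar crossed simplicial groups: those presented by saying that a functor $\Delta\mathfrak G^{op}\to\mathcal C$ is a simplicial object $X$ with automorphisms $t_n$ (and, in the cases involving $w$, also $w_n$) of $X_n$ with $d_0t_n=d_n$, $d_it_n=t_{n-1}d_{i-1}$ and $s_it_n=t_{n+1}s_{i-1}$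 for $1\le i\le n$, $s_0t_n=t_{n+1}^2s_n$, $d_iw_n=w_{n-1}d_{n-i}$, $s_iw_n=w_{n+1}s_{n-i}$, and the further relations: ($\Lambda_N$, $N\ge1$) $t_n^{N(n+1)}=1$; ($\Lambda_\infty$) none; ($\Xi_N$, $N\ge1$) $t_n^{N(n+1)}=1$, $w_n^2=1$, $w_nt_nw_n^{-1}=t_n^{-1}$; ($\Xi_\infty$) $w_n^2=1$, $w_nt_nw_n^{-1}=t_n^{-1}$; ($\nabla_M$, $M\ge1$) $w_n^2=t_n^{M(n+1)}$, $w_n^4=1$, $w_nt_nw_n^{-1}=t_n^{-1}$. Canonical parity on $\mathfrak G_0$: with $\omega_n:[n]\to[0]$ the unique map in $\Delta$, $\mathfrak G_0$ acts on the category $\Delta$ by $\phi\mapsto(\omega_n^*g)^*\phi$ for $\phi:[m]\to[n]$, giving a homomorphism $\mathfrak G_0\to\mathrm{Aut}(\Delta)\cong\mathbb Z/2$ (the nontrivial automorphism of $\Delta$ being order reversal). Elements mapping to $0$ are called even, the others odd. A twisted action of $\mathfrak G_0$ on $A$ is an action by $\mathbf k$-linear maps in which even elements act by algebra automorphisms and odd elements by algebra anti-automorphisms. *)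

(* Defs.v *)
From HB Require Import structures.
From mathcomp Require Import freeg.
From mathcomp Require Import all_boot all_algebra.
From mathcomp Require Import generic_quotient ring_quotient.
From mathcomp Require Import boolp.

Set Implicit Arguments.
Unset Strict Implicit.
Unset Printing Implicit Defensive.

Import GRing.Theory.

Local Open Scope group_scope.
Local Open Scope nat_scope.

(* The type of objects is a parameter, so that Delta and a crossed simplicial
   group can share the object type nat, the natural number n standing
   for [n] = {0, .., n}. *)
Record category (O : Type) := Category {
  mor : O -> O -> Type;
  idm : forall x, mor x x;
  compm : forall x y z, mor y z -> mor x y -> mor x z;
  comp1m : forall x y (f : mor x y), compm (idm y) f = f;
  compm1 : forall x y (f : mor x y), compm f (idm x) = f;
  compmA : forall x y z t (h : mor z t) (g : mor y z) (f : mor x y),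
    compm h (compm g f) = compm (compm h g) f }.

Arguments idm {O c} x.
Arguments compm {O c x y z} g f.
Notation "g \oc f" := (compm g f) (at level 40, left associativity).

Definition op O (C : category O) : category O :=
  @Category O (fun x y => mor C y x) (fun x => idm x)
    (fun x y z g f => f \oc g) (fun x y f => compm1 f) (fun x y f => comp1m f)
    (fun x y z t h g f => esym (compmA f g h)).

Record functor O (C : category O) O' (D : category O') (F0 : O -> O') := Functor {
  fmap : forall x y, mor C x y -> mor D (F0 x) (F0 y);
  fmap_id : forall x, fmap (idm x) = idm (F0 x);
  fmap_comp : forall x y z (g : mor C y z) (f : mor C x y),
    fmap (g \oc f) = fmap g \oc fmap f }.

Arguments fmap {O C O' D F0} F {x y} f : rename.

Record aut O (C : category O) (x : O) := Aut {
  aut_val :> mor C x x;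
  aut_inv : mor C x x;
  aut_valK : aut_inv \oc aut_val = idm x;
  aut_invK : aut_val \oc aut_inv = idm x }.

Section AutGroup.
Variables (O : Type) (C : category O) (x : O).
Implicit Types g h : aut C x.

Lemma aut_eq g h : aut_val g = aut_val h -> g = h.
Proof.
case: g h => [g g' gK g'K] [h h' hK h'K] /= gh; subst h.
have gh' : g' = h' by rewrite -[g']compm1 -h'K compmA gK comp1m.
by subst h'; rewrite (Prop_irrelevance gK hK) (Prop_irrelevance g'K h'K).
Qed.

Definition aut_one : aut C x := Aut (comp1m (idm x)) (comp1m (idm x)).

Definition aut_opp g : aut C x := Aut (aut_invK g) (aut_valK g).

Lemma aut_mulK g h :
  (aut_inv h \oc aut_inv g) \oc (aut_val g \oc aut_val h) = idm x.
Proof. by rewrite compmA -(compmA (aut_inv h)) aut_valK compm1 aut_valK. Qed.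

Lemma aut_mulKV g h :
  (aut_val g \oc aut_val h) \oc (aut_inv h \oc aut_inv g) = idm x.
Proof. by rewrite compmA -(compmA (aut_val g)) aut_invK compm1 aut_invK. Qed.

Definition aut_mul g h : aut C x := Aut (aut_mulK g h) (aut_mulKV g h).

Lemma aut_mulA : associative aut_mul.
Proof. by move=> f g h; apply: aut_eq; exact: compmA. Qed.
Lemma aut_mul1 : left_id aut_one aut_mul.
Proof. by move=> f; apply: aut_eq; exact: comp1m. Qed.
Lemma aut_1mul : right_id aut_one aut_mul.
Proof. by move=> f; apply: aut_eq; exact: compm1. Qed.
Lemma aut_mulV : left_inverse aut_one aut_opp aut_mul.
Proof. by move=> f; apply: aut_eq; exact: aut_valK. Qed.
Lemma aut_mulVr : right_inverse aut_one aut_opp aut_mul.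
Proof. by move=> f; apply: aut_eq; exact: aut_invK. Qed.

HB.instance Definition _ := gen_eqMixin (aut C x).
HB.instance Definition _ := gen_choiceMixin (aut C x).
HB.instance Definition _ :=
  isGroup.Build (aut C x) aut_mulA aut_mul1 aut_1mul aut_mulV aut_mulVr.

End AutGroup.

Section SimplexCategory.

Definition monotone m n (f : {ffun 'I_m.+1 -> 'I_n.+1}) : bool :=
  [forall i : 'I_m.+1, forall j : 'I_m.+1, (i <= j) ==> (f i <= f j)].

Definition dhom m n := {f : {ffun 'I_m.+1 -> 'I_n.+1} | monotone f}.

Lemma dhom_subproof m n (f : 'I_m.+1 -> 'I_n.+1) :
  (forall i j : 'I_m.+1, i <= j -> f i <= f j) -> monotone [ffun i => f i].
Proof.
by move=> h; do 2!apply/forallP => ?; apply/implyP => /h; rewrite !ffunE.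
Qed.

Definition mk_dhom m n (f : 'I_m.+1 -> 'I_n.+1) 
    (h : forall i j : 'I_m.+1, i <= j -> f i <= f j) :
  dhom m n := exist _ [ffun i => f i] (dhom_subproof h).

Lemma dhomP m n (f : dhom m n) (i j : 'I_m.+1) : i <= j -> sval f i <= sval f j.
Proof. case: f => f /= /forallP h; by move/forallP/(_ j)/implyP: (h i). Qed.

Definition dhom_id n : dhom n n := mk_dhom (fun i j (h : i <= j) => h).

Definition dhom_comp m n p (g : dhom n p) (f : dhom m n) : dhom m p :=
  mk_dhom (fun i j (h : i <= j) => dhomP g (dhomP f h)).

Lemma dhom_comp1m m n (f : dhom m n) : dhom_comp (dhom_id n) f = f.
Proof. by apply/val_inj/ffunP => i; rewrite /= !ffunE. Qed.
Lemma dhom_compm1 m n (f : dhom m n) : dhom_comp f (dhom_id m) = f.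
Proof. by apply/val_inj/ffunP => i; rewrite /= !ffunE. Qed.
Lemma dhom_compA m n p q (h : dhom p q) (g : dhom n p) (f : dhom m n) :
  dhom_comp h (dhom_comp g f) = dhom_comp (dhom_comp h g) f.
Proof. by apply/val_inj/ffunP => i; rewrite /= !ffunE. Qed.

Definition Delta : category nat :=
  Category dhom_comp1m dhom_compm1 dhom_compA.

Lemma coface_subproof n (i : 'I_n.+2) (j l : 'I_n.+1) :
  j <= l -> lift i j <= lift i l.
Proof. by rewrite /= leq_bump2. Qed.

(* The injection [n] -> [n+1] that omits i. *)
Definition coface n (i : 'I_n.+2) : mor Delta n n.+1 :=
  mk_dhom (@coface_subproof n i).

Lemma codegen_subproof n (i : 'I_n.+1) (j l : 'I_n.+2) :
  j <= l -> (inord (unbump i j) : 'I_n.+1) <= (inord (unbump i l) : 'I_n.+1).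
Proof.
have lt (m : 'I_n.+2) : unbump i m < n.+1.
  rewrite /unbump; case: (ltnP i m) => [im | mi] /=.
    by rewrite subn1 prednK ?(leq_ltn_trans _ im) // -ltnS.
  by rewrite subn0 (leq_ltn_trans mi).
move=> le_jl; rewrite !inordK //.
rewrite /unbump; case: (ltnP i j) => ij; case: (ltnP i l) => il /=.
- exact: leq_sub2r.
- by have := leq_trans (leq_trans ij le_jl) il; rewrite ltnn.
- by rewrite subn0 subn1 -ltnS (ltn_predK il) (leq_ltn_trans ij il).
- by rewrite !subn0.
Qed.

(* The surjection [n+1] -> [n] that takes the value i twice. *)
Definition codegen n (i : 'I_n.+1) : mor Delta n.+1 n :=
  mk_dhom (@codegen_subproof n i).

Definition to_zero n : mor Delta n 0 :=
  mk_dhom (fun i j (_ : i <= j) => leqnn (@ord0 0)).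

End SimplexCategory.

(* The embedding of Delta is taken to be the identity on objects, which
   amounts to naming the objects along the bijection. *)
Record crossed_simplicial_group := CrossedSimplicialGroup {
  csg_cat :> category nat;
  csg_emb : functor Delta csg_cat id;
  csg_emb_inj : forall m n, injective (@fmap _ _ _ _ _ csg_emb m n);
  csg_factor : forall m n (f : mor csg_cat m n),
    exists! pg : mor Delta m n * aut csg_cat m,
      f = fmap csg_emb pg.1 \oc pg.2 }.

Section Parity.
Variable G : crossed_simplicial_group.

Lemma csg_exchange m n (phi : mor Delta m n) (g : aut G n) :
  exists! pg : mor Delta m n * aut G m,
    g \oc fmap (csg_emb G) pg.1 = fmap (csg_emb G) phi \oc pg.2.
Proof.
have eqE (psi : mor Delta m n) (h : aut G m) :
    g \oc fmap (csg_emb G) psi = fmap (csg_emb G) phi \oc h <->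
    (g^-1 : aut G n) \oc fmap (csg_emb G) phi
      = fmap (csg_emb G) psi \oc (h^-1 : aut G m).
  split=> E.
    rewrite -[fmap _ phi]compm1 -(aut_invK h) (compmA _ h) -E.
    by rewrite !compmA /= aut_valK comp1m.
  rewrite -[fmap _ psi]compm1 -(aut_valK h) (compmA (fmap _ psi)).
  rewrite (_ : fmap _ psi \oc aut_inv h =
    (g^-1 : aut G n) \oc fmap (csg_emb G) phi) //.
  by rewrite !compmA /= aut_invK comp1m.
have [[psi h] /= [E U]] :=
  csg_factor ((g^-1 : aut G n) \oc fmap (csg_emb G) phi).
exists (psi, h^-1); split.
  by apply/(eqE psi (h^-1)); rewrite invgK.
move=> [psi' h'] /(eqE psi' h') E'.
by have [-> ->] := U (psi', h'^-1) E'; rewrite invgK.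
Qed.

(* g^*phi and phi^*g *)
Definition act_mor m n (g : aut G n) (phi : mor Delta m n) : mor Delta m n :=
  (projT1 (cid (csg_exchange phi g))).1.

Definition act_grp m n (phi : mor Delta m n) (g : aut G n) : aut G m :=
  (projT1 (cid (csg_exchange phi g))).2.

Lemma act_morE m n (phi : mor Delta m n) (g : aut G n) :
  g \oc fmap (csg_emb G) (act_mor g phi)
    = fmap (csg_emb G) phi \oc act_grp phi g.
Proof. by rewrite /act_mor /act_grp; case: cid => pg []. Qed.

Definition parity_action (g : aut G 0) m n (phi : mor Delta m n) :
  mor Delta m n := act_mor (act_grp (to_zero n) g) phi.

(* The kernel of G_0 -> Aut(Delta) = Z/2; the other elements are odd. *)
Definition even_elt (g : aut G 0) : Prop :=
  forall m n (phi : mor Delta m n), parity_action g phi = phi.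

End Parity.

Definition aut_image O (C : category O) O' (D : category O') X
    (F : functor (op C) D X) x (g : aut C x) : aut D (X x).
Proof.
exists (fmap F (g : mor (op C) x x)) (fmap F (aut_inv g : mor (op C) x x)).
- exact: etrans (esym (fmap_comp F _ _))
    (etrans (congr1 (fmap F) (aut_invK g)) (fmap_id F x)).
- exact: etrans (esym (fmap_comp F _ _))
    (etrans (congr1 (fmap F) (aut_valK g)) (fmap_id F x)).
Defined.

Definition restrict (G : crossed_simplicial_group) O (C : category O) X
    (F : functor (op G) C X) : functor (op Delta) C X.
Proof.
exists (fun m n (phi : mor (op Delta) m n) =>
  fmap F (fmap (csg_emb G) (phi : mor Delta n m) : mor (op G) m n)).
- move=> n; exact: etrans
    (congr1 (@fmap _ _ _ _ _ F n n) (fmap_id (csg_emb G) n)) (fmap_id F n).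
- move=> m n p psi phi.
  exact: etrans (congr1 (@fmap _ _ _ _ _ F m p)
    (fmap_comp (csg_emb G) (phi : mor Delta n m) (psi : mor Delta p n)))
    (@fmap_comp _ _ _ _ _ F m n p _ _).
Defined.

Inductive planar_type :=
  | Lambda of nat | Lambda_oo | Xi of nat | Xi_oo | Nabla of nat.

Definition planar_index_pos (p : planar_type) : bool :=
  match p with Lambda N | Xi N | Nabla N => 0 < N | _ => true end.

Definition has_reflection (p : planar_type) : bool :=
  match p with Lambda _ | Lambda_oo => false | _ => true end.

Section PlanarRelations.
Variables (p : planar_type) (O : Type) (C : category O) (X : nat -> O).
Variables (S : functor (op Delta) C X) (t : forall n, aut C (X n)).
Variable w : has_reflection p -> forall n, aut C (X n).

Definition sface n (i : 'I_n.+2) : mor C (X n.+1) (X n) :=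
  fmap S (coface i : mor (op Delta) n.+1 n).

Definition sdegen n (i : 'I_n.+1) : mor C (X n) (X n.+1) :=
  fmap S (codegen i : mor (op Delta) n n.+1).

Definition rotation_relations : Prop :=
  [/\ forall n, sface ord0 \oc t n.+1 = @sface n ord_max,
      forall n i, 1 <= i <= n.+1 ->
        @sface n (inord i) \oc t n.+1 = t n \oc sface (inord i.-1),
      forall n i, 1 <= i <= n ->
        @sdegen n (inord i) \oc t n = t n.+1 \oc sdegen (inord i.-1)
    & forall n, @sdegen n ord0 \oc t n = (t n.+1 ^+ 2)%g \oc sdegen ord_max].

(* rev_ord i is n - i for i in {0, .., n} *)
Definition reflection_relations (h : has_reflection p) : Prop :=
  (forall n (i : 'I_n.+2), sface i \oc w h n.+1 = w h n \oc sface (rev_ord i)) /\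
  (forall n (i : 'I_n.+1), sdegen i \oc w h n = w h n.+1 \oc sdegen (rev_ord i)).

Definition dihedral_relation (h : has_reflection p) : Prop :=
  forall n, (w h n * t n * (w h n)^-1 = (t n)^-1)%g.

Definition further_relations : Prop :=
  match p with
  | Lambda N => forall n, (t n ^+ (N * n.+1)%N = 1)%g
  | Lambda_oo => True
  | Xi N => (forall n, (t n ^+ (N * n.+1)%N = 1)%g) /\
      forall h, (forall n, (w h n ^+ 2 = 1)%g) /\ dihedral_relation h
  | Xi_oo =>
      forall h, (forall n, (w h n ^+ 2 = 1)%g) /\ dihedral_relation h
  | Nabla M =>
      forall h, [/\ forall n, (w h n ^+ 2 = t n ^+ (M * n.+1)%N)%g,
                    forall n, (w h n ^+ 4 = 1)%g & dihedral_relation h]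
  end.

Definition planar_relations : Prop :=
  [/\ rotation_relations, forall h, reflection_relations h & further_relations].

End PlanarRelations.

(* Functors (op G) -> C are the same as simplicial objects of C with
   automorphisms t_n, w_n subject to the relations: every functor gives such
   data, the images of pl_t and pl_w, and every such data comes from exactly one
   functor. *)
Record planar_presentation (p : planar_type) (G : crossed_simplicial_group) :=
  PlanarPresentation {
  pl_index_pos : planar_index_pos p;
  pl_t : forall n, aut G n;
  pl_w : has_reflection p -> forall n, aut G n;
  pl_sound : forall O (C : category O) (X : nat -> O) (F : functor (op G) C X),
    planar_relations (restrict F) (fun n => aut_image F (pl_t n))
      (fun h n => aut_image F (pl_w h n));
  pl_complete : forall O (C : category O) (X : nat -> O)
      (S : functor (op Delta) C X) (t : forall n, aut C (X n))
      (w : has_reflection p -> forall n, aut C (X n)),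
    planar_relations S t w ->
    exists! F : functor (op G) C X,
      [/\ restrict F = S, forall n, aut_image F (pl_t n) = t n
        & forall h n, aut_image F (pl_w h n) = w h n] }.

Local Open Scope ring_scope.

Section Tensor.
Variables (k : fieldType) (V : lmodType k) (n : nat).

Local Notation free := {freeg {ffun 'I_n -> V} / k}.

Definition upd (a : {ffun 'I_n -> V}) (i : 'I_n) (x : V) : {ffun 'I_n -> V} :=
  [ffun j => if j == i then x else a j].

Definition multilinear (U : lmodType k) (f : {ffun 'I_n -> V} -> U) : Prop :=
  forall a i (c : k) x y,
    f (upd a i (c *: x + y)) = c *: f (upd a i x) + f (upd a i y).

Definition tensor_gen a i (c : k) x y : free :=
  << upd a i (c *: x + y) >> - c *: << upd a i x >> - << upd a i y >>.

(* The submodule spanned by the multilinearity relations. *)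
Inductive tensor_rel : free -> Prop :=
| tensor_rel0 : tensor_rel 0
| tensor_relD c a i d x y z :
    tensor_rel z -> tensor_rel (c *: tensor_gen a i d x y + z).

Lemma tensor_rel_add x y : tensor_rel x -> tensor_rel y -> tensor_rel (x + y).
Proof.
by elim=> [|*]; rewrite ?add0r // -addrA; apply: tensor_relD; auto.
Qed.

Lemma tensor_relZ c x : tensor_rel x -> tensor_rel (c *: x).
Proof.
elim=> [|b a i d u v z _ IH]; first by rewrite scaler0; exact: tensor_rel0.
by rewrite scalerDr scalerA; exact: tensor_relD.
Qed.

Definition in_tensor_rel : {pred free} := fun x => `[< tensor_rel x >].

Lemma tensor_rel_closed : zmod_closed in_tensor_rel.
Proof.
split=> [|x y /asboolP rx /asboolP ry]; apply/asboolP; first exact: tensor_rel0.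
by rewrite -scaleN1r; apply: tensor_rel_add => //; exact: tensor_relZ.
Qed.

HB.instance Definition _ :=
  GRing.isZmodClosed.Build free in_tensor_rel tensor_rel_closed.

(* The n-th tensor power of V over k. *)
Definition tensor_power := Quotient.quot in_tensor_rel.

HB.instance Definition _ := GRing.Zmodule.on tensor_power.

Definition tensor_proj (x : free) : tensor_power := \pi_tensor_power%qT x.

Definition tensor_scale (c : k) (x : tensor_power) : tensor_power :=
  tensor_proj (c *: repr x).

Lemma tensor_projP x y : reflect (tensor_rel (x - y)) (tensor_proj x == tensor_proj y).
Proof. by rewrite /tensor_proj -Quotient.idealrBE; exact: asboolP. Qed.

Lemma tensor_projK x : tensor_proj (repr x) = x.
Proof. exact: reprK. Qed.

Lemma tensor_projD : {morph tensor_proj : x y / x + y}.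
Proof. exact: raddfD. Qed.

Lemma tensor_scale_proj c x : tensor_scale c (tensor_proj x) = tensor_proj (c *: x).
Proof.
apply/eqP/tensor_projP; rewrite -scalerBr; apply: tensor_relZ.
by apply/tensor_projP; rewrite tensor_projK.
Qed.

Lemma tensor_scaleA c d x :
  tensor_scale c (tensor_scale d x) = tensor_scale (c * d) x.
Proof. by rewrite -[x]tensor_projK !tensor_scale_proj scalerA. Qed.
Lemma tensor_scale1 : left_id 1 tensor_scale.
Proof. by move=> x; rewrite -[x]tensor_projK tensor_scale_proj scale1r. Qed.
Lemma tensor_scaleDr : right_distributive tensor_scale +%R.
Proof.
move=> c x y; rewrite -[x]tensor_projK -[y]tensor_projK.
by rewrite -tensor_projD !tensor_scale_proj scalerDr tensor_projD.
Qed.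
Lemma tensor_scaleDl x : {morph tensor_scale^~ x : c d / c + d}.
Proof.
by move=> c d; rewrite -[x]tensor_projK !tensor_scale_proj scalerDl tensor_projD.
Qed.

HB.instance Definition _ := GRing.Zmodule_isLmodule.Build k tensor_power
  tensor_scaleA tensor_scale1 tensor_scaleDr tensor_scaleDl.

Lemma tensor_proj_linear : linear tensor_proj.
Proof. by move=> c x y; rewrite tensor_projD -tensor_scale_proj. Qed.

HB.instance Definition _ :=
  GRing.isLinear.Build k free tensor_power *:%R tensor_proj tensor_proj_linear.

(* a 0 \otimes .. \otimes a (n - 1) *)
Definition tensor (a : {ffun 'I_n -> V}) : tensor_power := tensor_proj << a >>.

Lemma tensor_multilinear : multilinear tensor.
Proof.
move=> a i c x y; rewrite /tensor -linearP.
apply/eqP/tensor_projP; rewrite opprD addrA.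
rewrite -[X in tensor_rel X]scale1r -[X in tensor_rel X]addr0.
by apply: tensor_relD; exact: tensor_rel0.
Qed.

Section Lift.
Variables (U : lmodType k) (f : {ffun 'I_n -> V} -> U).
Hypothesis f_mlin : multilinear f.

HB.instance Definition _ := GRing.isZmodMorphism.Build free U (fglift f)
  (lift_is_additive f).

Lemma fgliftZ (c : k) (x : free) : fglift f (c *: x) = c *: fglift f x.
Proof.
rewrite -[x]freeg_sumE scaler_sumr !raddf_sum.
apply: eq_bigr => a _ /=; set b := coeff _ _.
have -> : c *: << b *g a >> = << (c * b) *g a >> :> free.
  by apply/eqP/freeg_eqP => z; rewrite coeffZ !coeffU mulrA.
by rewrite !liftU scalerA.
Qed.

Lemma fglift_rel x : tensor_rel x -> fglift f x = 0.
Proof.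
elim=> [|c a i d u v z _ IH]; first exact: raddf0.
rewrite raddfD /= IH addr0 fgliftZ /tensor_gen !raddfB /= fgliftZ !liftU.
by rewrite !scale1r f_mlin scalerDr addrAC addrK subrr.
Qed.

Definition tensor_lift_fun (x : tensor_power) : U := fglift f (repr x).

Lemma tensor_lift_proj x : tensor_lift_fun (tensor_proj x) = fglift f x.
Proof.
apply/eqP; rewrite -subr_eq0 -raddfB /= fglift_rel //.
by apply/tensor_projP; rewrite tensor_projK.
Qed.

Lemma tensor_lift_linear : linear tensor_lift_fun.
Proof.
move=> c x y; rewrite -[x]tensor_projK -[y]tensor_projK -linearP.
by rewrite !tensor_lift_proj raddfD /= fgliftZ.
Qed.

HB.instance Definition _ :=
  GRing.isLinear.Build k tensor_power U *:%R tensor_lift_fun tensor_lift_linear.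

Definition tensor_lift : {linear tensor_power -> U} := tensor_lift_fun.

Lemma tensor_liftE a : tensor_lift (tensor a) = f a.
Proof. by rewrite /= tensor_lift_proj liftU scale1r. Qed.

End Lift.

Lemma tensor_span (U : lmodType k) (g h : {linear tensor_power -> U}) :
  (forall a, g (tensor a) = h (tensor a)) -> g =1 h.
Proof.
move=> gh x; rewrite -[x]tensor_projK -[repr x]freeg_sumE.
rewrite !linear_sum; apply: eq_bigr => a _.
have -> : << coeff a (repr x) *g a >> = coeff a (repr x) *: << a >> :> free.
  by apply/eqP/freeg_eqP => z; rewrite coeffZ !coeffU mul1r.
by rewrite !linearZ; congr (_ *: _); exact: gh.
Qed.

End Tensor.

Section TensorMap.
Variables (k : fieldType) (V W : lmodType k) (f : {linear V -> W}) (n : nat).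

Definition tensor_map_fun (a : {ffun 'I_n -> V}) : tensor_power W n :=
  tensor [ffun i => f (a i)].

Lemma tensor_map_multilinear : multilinear tensor_map_fun.
Proof.
move=> a i c x y; rewrite /tensor_map_fun.
have E z : [ffun j => f (upd a i z j)] = upd [ffun j => f (a j)] i (f z).
  by apply/ffunP => j; rewrite !ffunE; case: eqP.
by rewrite !E linearP tensor_multilinear.
Qed.

Definition tensor_map : {linear tensor_power V n -> tensor_power W n} :=
  tensor_lift tensor_map_multilinear.

Lemma tensor_mapE (a : {ffun 'I_n -> V}) :
  tensor_map (tensor a) = tensor [ffun i => f (a i)].
Proof. exact: tensor_liftE. Qed.

End TensorMap.

Section Vect.
Variable k : fieldType.

Lemma linear_eq (U V : lmodType k) (f g : {linear U -> V}) : f =1 g -> f = g.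
Proof.
case: f g => [f [[fD] [fZ]]] [g [[gD] [gZ]]] /= /funext fg; subst g.
by rewrite (Prop_irrelevance fD gD) (Prop_irrelevance fZ gZ).
Qed.

Definition vect_id (U : lmodType k) : {linear U -> U} := idfun.
Definition vect_comp (U V W : lmodType k)
  (g : {linear V -> W}) (f : {linear U -> V}) : {linear U -> W} := g \o f.

Lemma vect_comp1m (U V : lmodType k) (f : {linear U -> V}) :
  vect_comp (vect_id V) f = f.
Proof. exact: linear_eq. Qed.
Lemma vect_compm1 (U V : lmodType k) (f : {linear U -> V}) :
  vect_comp f (vect_id U) = f.
Proof. exact: linear_eq. Qed.
Lemma vect_compA (U V W X : lmodType k)
    (h : {linear W -> X}) (g : {linear V -> W}) (f : {linear U -> V}) :
  vect_comp h (vect_comp g f) = vect_comp (vect_comp h g) f.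
Proof. exact: linear_eq. Qed.

Definition Vect : category (lmodType k) :=
  Category vect_comp1m vect_compm1 vect_compA.

Definition linear_action (H : groupType) (V : lmodType k)
    (r : H -> {linear V -> V}) : Prop :=
  (forall x, r 1%g x = x) /\ forall g h x, r (g * h)%g x = r g (r h x).

(* Unital associative algebras, the zero algebra included; the algebras of
   type algType are those with 1 != 0. *)
Record unital_algebra := UnitalAlgebra {
  ualg_mod :> lmodType k;
  ualg_one : ualg_mod;
  ualg_mul : ualg_mod -> ualg_mod -> ualg_mod;
  ualg_mulA : associative ualg_mul;
  ualg_mul1 : left_id ualg_one ualg_mul;
  ualg_1mul : right_id ualg_one ualg_mul;
  ualg_linear_l : forall b, linear (ualg_mul^~ b);
  ualg_linear_r : forall a, linear (ualg_mul a) }.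

Lemma alg_linear_l (A : algType k) (b : A) : linear ( *%R^~ b).
Proof. by move=> c x y; rewrite mulrDl scalerAl. Qed.

Lemma alg_linear_r (A : algType k) (a : A) : linear ( *%R a).
Proof. by move=> c x y; rewrite mulrDr scalerAr. Qed.

Definition unital_algebra_of (A : algType k) : unital_algebra :=
  @UnitalAlgebra A 1 *%R (@mulrA A) (@mul1r A) (@mulr1 A)
    (@alg_linear_l A) (@alg_linear_r A).

End Vect.

Arguments ualg_one {k} A : rename.
Arguments ualg_mul {k A} a b : rename.

Notation "a ** b" := (ualg_mul a b) (at level 40, left associativity).

(* A left action of the group G_0; an action by automorphisms, bijectivity
   being automatic. *)
Record twisted_action (k : fieldType) (G : crossed_simplicial_group)
    (A : unital_algebra k) := TwistedAction {
  tw_act :> aut G 0 -> {linear A -> A};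
  tw_action : linear_action tw_act;
  tw_one : forall g, tw_act g (ualg_one A) = ualg_one A;
  tw_even : forall g, even_elt g ->
    forall a b : A, tw_act g (a ** b) = tw_act g a ** tw_act g b;
  tw_odd : forall g, ~ even_elt g ->
    forall a b : A, tw_act g (a ** b) = tw_act g b ** tw_act g a }.

Record equivariant_alg_hom (k : fieldType) (G : crossed_simplicial_group)
    (A B : unital_algebra k) (rho : twisted_action G A)
    (sigma : twisted_action G B) := EquivariantAlgHom {
  eah_map :> {linear A -> B};
  eah_one : eah_map (ualg_one A) = ualg_one B;
  eah_mul : forall a b, eah_map (a ** b) = eah_map a ** eah_map b;
  eah_act : forall g a, eah_map (rho g a) = sigma g (eah_map a) }.

(* C_n(A) *)
Definition hochschild (k : fieldType) (A : lmodType k) (n : nat) : lmodType k :=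
  tensor_power A n.+1.

Section HochschildFormulas.
Variables (k : fieldType) (A : unital_algebra k) (n : nat).

(* a_0, .., a_i a_(i+1), .., a_(n+1) *)
Definition face_fun (i : 'I_n.+1) (a : {ffun 'I_n.+2 -> A}) :
    {ffun 'I_n.+1 -> A} :=
  [ffun j : 'I_n.+1 =>
    if (j < i)%N then a (inord j)
    else if j == i then a (inord i) ** a (inord i.+1)
    else a (inord j.+1)].

(* t(a_(n+1)) a_0, a_1, .., a_n *)
Definition last_face_fun (t : A -> A) (a : {ffun 'I_n.+2 -> A}) :
    {ffun 'I_n.+1 -> A} :=
  [ffun j : 'I_n.+1 =>
    if j == ord0 then t (a ord_max) ** a ord0 else a (inord j)].

(* a_0, .., a_i, 1, a_(i+1), .., a_n *)
Definition degen_fun (i : 'I_n.+1) (a : {ffun 'I_n.+1 -> A}) :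
    {ffun 'I_n.+2 -> A} :=
  [ffun j : 'I_n.+2 =>
    if (j <= i)%N then a (inord j)
    else if j == i.+1 :> nat then ualg_one A
    else a (inord j.-1)].

(* t(a_n), a_0, .., a_(n-1) *)
Definition rotation_fun (t : A -> A) (a : {ffun 'I_n.+1 -> A}) :
    {ffun 'I_n.+1 -> A} :=
  [ffun j : 'I_n.+1 => if j == ord0 then t (a ord_max) else a (inord j.-1)].

(* w(a_0), w(t(a_n)), .., w(t(a_1)) *)
Definition reflection_fun (t w : A -> A) (a : {ffun 'I_n.+1 -> A}) :
    {ffun 'I_n.+1 -> A} :=
  [ffun j : 'I_n.+1 =>
    if j == ord0 then w (a ord0) else w (t (a (inord (n.+1 - j))))].

End HochschildFormulas.

Section HochschildObject.
Variables (k : fieldType) (G : crossed_simplicial_group).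
Variables (p : planar_type) (P : planar_presentation p G).
Variables (A : unital_algebra k) (rho : twisted_action G A).
Variable F : functor (op G) (Vect k) (hochschild A).

Definition hoch_map m n (f : mor G m n) :
    {linear hochschild A n -> hochschild A m} :=
  fmap F (f : mor (op G) n m).

(* F is contravariant while rho is a left action, so that F is compared with
   rho through inverses. *)
Definition op_t (a : A) : A := rho (pl_t P 0)^-1%g a.
Definition op_w (h : has_reflection p) (a : A) : A := rho (pl_w P h 0)^-1%g a.

Record is_hochschild : Prop := IsHochschild {
  hoch_zero : forall (g : aut G 0) (a : {ffun 'I_1 -> A}),
    hoch_map g (tensor a) = tensor [ffun i => rho g^-1%g (a i)];
  hoch_face : forall n (i : 'I_n.+1) (a : {ffun 'I_n.+2 -> A}),
    hoch_map (fmap (csg_emb G) (coface (lift ord_max i))) (tensor a)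
      = tensor (face_fun i a);
  hoch_last_face : forall n (a : {ffun 'I_n.+2 -> A}),
    hoch_map (fmap (csg_emb G) (@coface n ord_max)) (tensor a)
      = tensor (last_face_fun op_t a);
  hoch_degen : forall n (i : 'I_n.+1) (a : {ffun 'I_n.+1 -> A}),
    hoch_map (fmap (csg_emb G) (codegen i)) (tensor a)
      = tensor (degen_fun i a);
  hoch_rotation : forall n (a : {ffun 'I_n.+1 -> A}),
    hoch_map (pl_t P n) (tensor a) = tensor (rotation_fun op_t a);
  hoch_reflection : forall h n (a : {ffun 'I_n.+1 -> A}),
    hoch_map (pl_w P h n) (tensor a)
      = tensor (reflection_fun op_t (op_w h) a) }.

End HochschildObject.

(* Main.v *)
(* The simplicial structure extends to a monotone map phi : [m] -> [n] by
   sending a_0 (x) .. (x) a_n to the tensor whose j-th factor is the product of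
   the a_i with phi (j - 1) < i <= phi j, in cyclic order; the elements a_i with
   i > phi m wrap around to the factor 0 and are moved there by the twist t.
   This is a functor because t_0 is even: t_n^(n+1) is the pullback of t_0 to
   [n], and it commutes with Delta. As w_n reverses the order, w_0 is odd. With
   this, the relations of the presentation are checked on tuples, and the
   presentation yields the functor.
   The action of an arbitrary element of G_0 and naturality reduce to t and w:
   the morphisms phi o g with g a word in t and w form a subcategory of G, and
   by uniqueness in the universal property it is all of G. *)

Require Import Defs.
From HB Require Import structures.
From mathcomp Require Import all_boot all_algebra.
From mathcomp Require Import boolp zify.

Set Implicit Arguments.
Unset Strict Implicit.
Unset Printing Implicit Defensive.

Import GRing.Theory.

(** * Generation of the simplex category *)

(** Objects of [Delta] are related by all monotone maps, not by generators, so the simplicial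
    structure has to be given on every map at once and composed in general. The difficulty is the
    cyclic interval belonging to the factor 0. Continuing maps and tuples over two periods removes
    it: every factor becomes a product over an ordinary interval, and functoriality becomes a
    telescoping product. Two periods suffice because factor 0 reaches back by at most one turn.
    Generation of [Delta] by cofaces and codegeneracies serves another purpose. The presentation
    says only how [t] and [w] pass these maps, whereas the parity of $t_0$ and the closure of words
    under composition concern all monotone maps. Nothing is assumed about the elements of the group
    $\mathfrak G_n$ beyond the universal property, which is why generation by [t] and [w] is deduced
    from uniqueness of functors. On tensors all identities are tested on pure tensors, hence on
    tuples; a map of tuples descends as soon as it is linear in each entry separately. *)

Inductive simplicial_word : forall m n, mor Delta m n -> Prop :=
| word_id n : simplicial_word (idm n : mor Delta n n)
| word_coface n (i : 'I_n.+2) : simplicial_word (coface i)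
| word_codegen n (i : 'I_n.+1) : simplicial_word (codegen i)
| word_comp m n l (g : mor Delta n l) (f : mor Delta m n) :
    simplicial_word g -> simplicial_word f -> simplicial_word (g \oc f).

Lemma codegenE n (i : 'I_n.+1) (j : 'I_n.+2) :
  sval (codegen i) j = (if (j <= i)%N then j : nat else j.-1) :> nat.
Proof.
have ? := ltn_ord i; have ? := ltn_ord j.
by rewrite /= ffunE inordK /unbump; case: ltnP; lia.
Qed.

Lemma cofaceE n (i : 'I_n.+2) (j : 'I_n.+1) :
  sval (coface i) j = (if (j < i)%N then j : nat else j.+1) :> nat.
Proof. by rewrite /= ffunE /= /bump; case: ltnP; lia. Qed.

Lemma dhom_compE m n l (g : mor Delta n l) (f : mor Delta m n) j :
  sval (g \oc f) j = sval g (sval f j).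
Proof. by rewrite /= ffunE. Qed.

Lemma dhom_eq m n (f g : mor Delta m n) :
  (forall j, sval f j = sval g j :> nat) -> f = g.
Proof. by move=> fg; apply/val_inj/ffunP => j; apply/val_inj/fg. Qed.

(** Such a map is constant on the fibres of [codegen i], and the coface omitting $i+1$ is a section
    of [codegen i]. *)
Lemma dhom_factor_codegen m n (f : mor Delta m.+1 n) (i : 'I_m.+1) :
  sval f (inord i) = sval f (inord i.+1) ->
  f = (f \oc coface (inord i.+1)) \oc codegen i.
Proof.
move=> fi; apply: dhom_eq => j; rewrite !dhom_compE.
have lt_i := ltn_ord i.
have := cofaceE (inord i.+1) (sval (codegen i) j).
rewrite codegenE inordK //; case: (ltngtP j i.+1) => ji.
- rewrite (_ : j <= i)%N // ji => E.
  by congr (nat_of_ord (sval f _)); apply/esym/val_inj.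
- have [-> ->] : (j <= i)%N = false /\ (j.-1 < i.+1)%N = false by split; lia.
  move=> E.
  congr (nat_of_ord (sval f _)); apply/esym/val_inj/(etrans E).
  by rewrite prednK //; lia.
- rewrite ji ltnn /= ltnSn => E.
  have -> : sval (coface (inord i.+1)) (sval (codegen i) j) = inord i.
    by apply/val_inj/(etrans E); rewrite [val (inord _)]inordK // ltnW.
  rewrite fi; congr (nat_of_ord (sval f _)); apply/val_inj.
  by rewrite [val (inord _)]inordK.
Qed.

Lemma dhom_factor_coface m n (f : mor Delta m n.+1) (i : 'I_n.+2) :
  (forall j, sval f j != i) ->
  exists g : mor Delta m n, f = coface i \oc g.
Proof.
(* For $i=0$ the truncated predecessor gives [codegen] at 0, which still lowers every value of [f]
   by one, all of them being positive. *)
move=> fi; exists (codegen (inord i.-1) \oc f); apply: dhom_eq => j.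
rewrite !dhom_compE cofaceE codegenE inordK; last by have := ltn_ord i; lia.
move: (fi j); rewrite -(inj_eq val_inj) /=.
by case: (leqP (sval f j) i.-1) => ?; case: leqP; have := ltn_ord i; lia.
Qed.

(** Strict monotonicity gives $j\le f(j)$. For the other bound, induction on a value $k$ shows that
    a preimage of $k$ is at least $k$: the value $k-1$ is attained, and strictly earlier. *)
Lemma dhom_inj_surj m n (f : mor Delta m n) :
  injective (sval f) -> (forall i, exists j, sval f j = i) ->
  forall j : 'I_m.+1, sval f j = j :> nat.
Proof.
move=> f_inj f_surj.
have f_mono (i j : 'I_m.+1) : i < j -> sval f i < sval f j.
  move=> ij; rewrite ltn_neqAle dhomP ?(ltnW ij) // andbT.
  by apply/eqP => /val_inj /f_inj E; move: ij; rewrite E ltnn.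
have ge (j : 'I_m.+1) : j <= sval f j.
  case: j => j; elim: j => [//|j IH] lt_j.
  by apply: leq_ltn_trans (IH (ltnW lt_j)) _; exact: f_mono.
have le (k : nat) (i : 'I_n.+1) :
    k = i -> forall j : 'I_m.+1, sval f j = i -> i <= j.
  elim: k i => [|k IH] i Ek j Ej; first by rewrite -Ek.
  have lt_k : k < n.+1 by have := ltn_ord i; lia.
  have [j' Ej'] := f_surj (Ordinal lt_k).
  have := IH (Ordinal lt_k) erefl _ Ej'; rewrite -Ek /= => kj'.
  apply: leq_ltn_trans kj' _; rewrite ltnNge; apply/negP => jj'.
  by have := dhomP f jj'; rewrite Ej Ej' -Ek /= ltnn.
by move=> j; apply/eqP; rewrite eqn_leq ge (le (sval f j) (sval f j)).
Qed.

(** Induction on $m+n$: a repetition at neighbours splits off a codegeneracy, a missed value splits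
    off a coface, and a map with neither is a bijection, hence an identity. *)
Lemma simplicial_wordP m n (f : mor Delta m n) : simplicial_word f.
Proof.
have [s] := ubnP (m + n); elim: s => // s IH in m n f *; rewrite ltnS => le_s.
case: (pselect (exists i : 'I_m, sval f (inord i) = sval f (inord i.+1))).
  case: m f le_s => [|m] f le_s [i]; first by case: i.
  move=> /dhom_factor_codegen ->.
  by apply: word_comp; [apply: IH; lia | exact: word_codegen].
move=> no_rep.
case: (pselect (exists i, forall j, sval f j != i)) => [|no_gap].
  case: n f le_s no_rep => [|n] f le_s _ [i].
    by move=> /(_ ord0); rewrite [sval f _]ord1 [i]ord1.
  move=> /dhom_factor_coface [g ->].
  by apply: word_comp; [exact: word_coface | apply: IH; lia].
have f_inj : injective (sval f).
  move=> i j; apply: contra_eq; rewrite -(inj_eq val_inj) neq_ltn.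
  wlog lt_ij : i j / i < j => [wl /orP[ij|ji]|_].
  - by apply: wl => //; rewrite ij.
  - by rewrite eq_sym; apply: wl => //; rewrite ji.
  have lt_i : i < m by have := ltn_ord j; lia.
  (* By monotonicity, equal values at $i<j$ force equal values at $i$ and $i+1$. *)
  apply/eqP => E; apply: no_rep; exists (Ordinal lt_i); rewrite /= inord_val.
  apply/val_inj/eqP; rewrite eqn_leq {2}E.
  by rewrite !dhomP // inordK //; lia.
have f_surj i : exists j, sval f j = i.
  apply: contra_notP no_gap => H; exists i => j.
  by apply: contra_notT H => /negPn/eqP <-; exists j.
have le_nm : #|'I_n.+1| <= #|'I_m.+1|.
  rewrite -(card_codom f_inj); apply/subset_leq_card/subsetP => i _.
  by apply/codomP; have [j <-] := f_surj i; exists j.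
have mn : m = n.
  by have /bij_eq_card := inj_card_bij f_inj le_nm; rewrite !card_ord => -[].
move: (dhom_inj_surj f_inj f_surj); case: _ / mn f {le_s no_rep no_gap f_inj f_surj}.
move=> f fE; have -> : f = idm m by apply: dhom_eq => j; rewrite fE /= ffunE.
exact: word_id.
Qed.

(** * Functors and automorphisms *)

Definition functor_id O (C : category O) : functor C C id :=
  @Functor _ C _ C id (fun _ _ f => f) (fun _ => erefl) (fun _ _ _ _ _ => erefl).

Lemma functor_eq O (C : category O) O' (D : category O') (X : O -> O')
    (F F' : functor C D X) :
  (forall x y (f : mor C x y), fmap F f = fmap F' f) -> F = F'.
Proof.
case: F F' => [F F1 FM] [F' F1' FM'] /= FF'.
have E : F = F'.
  apply/functional_extensionality_dep => x.
  apply/functional_extensionality_dep => y.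
  by apply/functional_extensionality_dep => f; exact: FF'.
subst F'.
by rewrite (Prop_irrelevance F1 F1') (Prop_irrelevance FM FM').
Qed.

Definition functor_comp O (C : category O) O' (D : category O')
    O'' (E : category O'') (X : O -> O') (Y : O' -> O'')
    (F' : functor D E Y) (F : functor C D X) : functor C E (fun x => Y (X x)).
Proof.
exists (fun x y f => fmap F' (fmap F f)).
- by move=> x; rewrite !fmap_id.
- by move=> x y z g f; rewrite !fmap_comp.
Defined.

Section AutMap.
Variables (O : Type) (C : category O) (O' : Type) (D : category O').
Variables (X : O -> O') (F : functor C D X) (x : O).

Definition aut_map (g : aut C x) : aut D (X x).
Proof.
exists (fmap F (aut_val g)) (fmap F (aut_inv g)).
- by rewrite -fmap_comp aut_valK fmap_id.
- by rewrite -fmap_comp aut_invK fmap_id.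
Defined.

Lemma aut_map1 : aut_map 1%g = 1%g.
Proof. by apply: aut_eq; exact: fmap_id. Qed.

Lemma aut_mapM g h : aut_map (g * h)%g = (aut_map g * aut_map h)%g.
Proof. by apply: aut_eq; exact: fmap_comp. Qed.

Lemma aut_mapV g : aut_map g^-1%g = (aut_map g)^-1%g.
Proof. exact: aut_eq. Qed.

Lemma aut_mapX g n : aut_map (g ^+ n)%g = (aut_map g ^+ n)%g.
Proof.
elim: n => [|n IH]; first exact: aut_map1.
by rewrite !expgS aut_mapM IH.
Qed.

End AutMap.

(** These relations are equations between words in automorphism groups, so a functor that is
    injective on automorphisms reflects them. This passes them from [op G] to the subcategory of
    words. *)
Lemma further_relations_faithful p O (C : category O) O' (C' : category O')
    (X : nat -> O) (Y : O -> O') (F : functor C C' Y)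
    (t : forall n, aut C (X n)) (w : has_reflection p -> forall n, aut C (X n)) :
  (forall x, injective (@aut_map _ _ _ _ _ F x)) ->
  further_relations (fun n => aut_map F (t n)) (fun h n => aut_map F (w h n)) ->
  further_relations t w.
Proof.
move=> F_inj; rewrite /further_relations /dihedral_relation.
have FE := (aut_mapM, aut_mapV, aut_mapX, aut_map1).
case: p w => [N||N||M] w //.
- by move=> H n; apply: F_inj; rewrite !FE; exact: H.
- move=> [H1 H2]; split=> [n|h].
    by apply: F_inj; rewrite !FE; exact: H1.
  have [H3 H4] := H2 h.
  by split=> n; apply: F_inj; rewrite !FE; [exact: H3 | exact: H4].
- move=> H2 h; have [H3 H4] := H2 h.
  by split=> n; apply: F_inj; rewrite !FE; [exact: H3 | exact: H4].
- move=> H2 h; have [H3 H4 H5] := H2 h.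
  by split=> n; apply: F_inj; rewrite !FE; [exact: H3 | exact: H4 | exact: H5].
Qed.

Lemma inv_exchange O (C : category O) (x y : O) (f f' : mor C x y)
    (g : aut C y) (h : aut C x) :
  aut_val g \oc f = f' \oc aut_val h ->
  aut_val g^-1%g \oc f' = f \oc aut_val h^-1%g.
Proof.
move=> E; rewrite -[f \oc _]comp1m -(aut_valK g) -compmA (compmA _ f) E.
by rewrite -(compmA f') aut_invK compm1.
Qed.

(* Automorphisms in C and in its opposite: the same maps, multiplied in the
   reverse order. *)
Definition aut_flip O (C : category O) x (g : aut (op C) x) : aut C x :=
  @Aut O C x (aut_val g) (aut_inv g) (aut_invK g) (aut_valK g).

(** * Generation of planar crossed simplicial groups *)

Section Generators.
Variables (G : crossed_simplicial_group) (p : planar_type).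
Variable P : planar_presentation p G.
Local Notation emb := (fmap (csg_emb G)).
Local Notation t := (pl_t P).
Local Notation w := (pl_w P).

(** The identity functor is the universal planar object: its relations are the relations of [t] and
    [w] inside [G], with composition reversed. *)
Let rels := pl_sound P (functor_id (op G)).

Lemma t_coface0 n :
  aut_val (t n.+1) \oc emb (@coface n ord0) = emb (coface ord_max).
Proof. by have [[h _ _ _] _ _] := rels; exact: h n. Qed.

Lemma t_coface n i : 1 <= i <= n.+1 ->
  aut_val (t n.+1) \oc emb (@coface n (inord i))
    = emb (coface (inord i.-1)) \oc aut_val (t n).
Proof. by have [[_ h _ _] _ _] := rels; exact: h n i. Qed.

Lemma t_codegen n i : 1 <= i <= n ->
  aut_val (t n) \oc emb (@codegen n (inord i))
    = emb (codegen (inord i.-1)) \oc aut_val (t n.+1).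
Proof. by have [[_ _ h _] _ _] := rels; exact: h n i. Qed.

Lemma t_codegen0 n :
  aut_val (t n) \oc emb (@codegen n ord0)
    = emb (codegen ord_max) \oc aut_val (t n.+1 ^+ 2)%g.
Proof. by have [[_ _ _ h] _ _] := rels; exact: h n. Qed.

Lemma w_coface h n i :
  aut_val (w h n.+1) \oc emb (@coface n i)
    = emb (coface (rev_ord i)) \oc aut_val (w h n).
Proof. by have [_ H _] := rels; exact: (H h).1 n i. Qed.

Lemma w_codegen h n i :
  aut_val (w h n) \oc emb (@codegen n i)
    = emb (codegen (rev_ord i)) \oc aut_val (w h n.+1).
Proof. by have [_ H _] := rels; exact: (H h).2 n i. Qed.

(** Inverses of the letters are included because $t_n$ may have infinite order. *)
Inductive generated_aut n : aut G n -> Prop :=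
| generated1 : generated_aut 1%g
| generated_t : generated_aut (t n)
| generated_tV : generated_aut (t n)^-1%g
| generated_w h : generated_aut (w h n)
| generated_wV h : generated_aut (w h n)^-1%g
| generatedM g g' : generated_aut g -> generated_aut g' -> generated_aut (g * g')%g.

(** Each letter that passes a coface leaves one letter of the same kind behind, except where the
    index wraps around: [t] at the coface 0 and its inverse at the last coface leave nothing. *)
Lemma generated_aut_coface n (g : aut G n.+1) i : generated_aut g ->
  exists j (g' : aut G n), generated_aut g' /\
    aut_val g \oc emb (coface i) = emb (coface j) \oc aut_val g'.
Proof.
move=> gen_g; elim: gen_g i => {g} [||| h | h | g g' _ IH _ IH'] i.
- exists i, 1%g; split; first exact: generated1.
  by rewrite comp1m compm1.
- have [i0|i_gt0] := posnP i.
    have -> : i = ord0 by apply/val_inj.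
    exists ord_max, 1%g; split; first exact: generated1.
    by rewrite t_coface0 compm1.
  exists (inord i.-1), (t n); split; first exact: generated_t.
  by rewrite -t_coface ?inord_val // i_gt0 -ltnS ltn_ord.
- have [lt_i|] := ltnP i n.+1.
    exists (inord i.+1), (t n)^-1%g; split; first exact: generated_tV.
    by apply: inv_exchange; rewrite t_coface // inord_val.
  move=> le_i; have -> : i = ord_max.
    by apply/val_inj/eqP; rewrite eqn_leq le_i -ltnS ltn_ord.
  exists ord0, 1%g; split; first exact: generated1.
  have -> : 1%g = (1%g^-1)%g :> aut G n by rewrite invg1.
  by apply: inv_exchange; rewrite t_coface0 compm1.
- exists (rev_ord i), (w h n); split; first exact: generated_w.
  exact: w_coface.
- exists (rev_ord i), (w h n)^-1%g; split; first exact: generated_wV.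
  by apply: inv_exchange; rewrite w_coface rev_ordK.
- have [j' [h' [gen_h' E']]] := IH' i; have [j [h [gen_h E]]] := IH j'.
  exists j, (h * h')%g; split; first exact: generatedM.
  by rewrite /= -compmA E' compmA E -compmA.
Qed.

(** At a codegeneracy the wrap-around leaves two letters instead of one, by the relation
    $s_0t_n=t_{n+1}^2s_n$. *)
Lemma generated_aut_codegen n (g : aut G n) i : generated_aut g ->
  exists j (g' : aut G n.+1), generated_aut g' /\
    aut_val g \oc emb (codegen i) = emb (codegen j) \oc aut_val g'.
Proof.
move=> gen_g; elim: gen_g i => {g} [||| h | h | g g' _ IH _ IH'] i.
- exists i, 1%g; split; first exact: generated1.
  by rewrite comp1m compm1.
- have [i0|i_gt0] := posnP i.
    have -> : i = ord0 by apply/val_inj.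
    exists ord_max, (t n.+1 ^+ 2)%g; split; last exact: t_codegen0.
    by rewrite expg2; apply: generatedM; exact: generated_t.
  exists (inord i.-1), (t n.+1); split; first exact: generated_t.
  by rewrite -t_codegen ?inord_val // i_gt0 -ltnS ltn_ord.
- have [lt_i|] := ltnP i n.
    exists (inord i.+1), (t n.+1)^-1%g; split; first exact: generated_tV.
    by apply: inv_exchange; rewrite t_codegen // inord_val.
  move=> le_i; have -> : i = ord_max.
    by apply/val_inj/eqP; rewrite eqn_leq le_i -ltnS ltn_ord.
  exists ord0, (t n.+1 ^+ 2)^-1%g; split.
    by rewrite expg2 invgM; apply: generatedM; exact: generated_tV.
  by apply: inv_exchange; exact: t_codegen0.
- exists (rev_ord i), (w h n.+1); split; first exact: generated_w.
  exact: w_codegen.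
- exists (rev_ord i), (w h n.+1)^-1%g; split; first exact: generated_wV.
  by apply: inv_exchange; rewrite w_codegen rev_ordK.
- have [j' [h' [gen_h' E']]] := IH' i; have [j [h [gen_h E]]] := IH j'.
  exists j, (h * h')%g; split; first exact: generatedM.
  by rewrite /= -compmA E' compmA E -compmA.
Qed.

Lemma generated_aut_exchange m n (phi : mor Delta m n) (g : aut G n) :
  generated_aut g ->
  exists (psi : mor Delta m n) (g' : aut G m), generated_aut g' /\
    aut_val g \oc emb phi = emb psi \oc aut_val g'.
Proof.
elim: (simplicial_wordP phi) g => {m n phi}
  [n|n i|n i|m n l psi phi _ IH _ IH'] g gen_g.
- exists (idm n), g; split => //.
  by rewrite fmap_id comp1m compm1.
- have [j [g' [? ?]]] := generated_aut_coface i gen_g.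
  by exists (coface j), g'.
- have [j [g' [? ?]]] := generated_aut_codegen i gen_g.
  by exists (codegen j), g'.
- have [psi' [g' [gen_g' E]]] := IH _ gen_g.
  have [phi' [g'' [? E']]] := IH' _ gen_g'.
  exists (psi' \oc phi'), g''; split => //.
  by rewrite !fmap_comp compmA E -compmA E' compmA.
Qed.

Definition gen_mor m n (f : mor G m n) : Prop :=
  exists (phi : mor Delta m n) (g : aut G m),
    generated_aut g /\ f = emb phi \oc aut_val g.

Lemma gen_mor_emb m n (phi : mor Delta m n) : gen_mor (emb phi).
Proof. by exists phi, 1%g; split; [exact: generated1 | rewrite compm1]. Qed.

Lemma gen_mor_aut n (g : aut G n) : generated_aut g -> gen_mor (aut_val g).
Proof. by exists (idm n), g; split; rewrite // fmap_id comp1m. Qed.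

Lemma gen_mor_comp m n l (f : mor G n l) (f' : mor G m n) :
  gen_mor f -> gen_mor f' -> gen_mor (f \oc f').
Proof.
move=> [phi [g [gen_g ->]]] [phi' [g' [gen_g' ->]]].
have [psi [h [gen_h E]]] := generated_aut_exchange phi' gen_g.
exists (phi \oc psi), (h * g')%g; split; first exact: generatedM.
by rewrite fmap_comp -compmA (compmA _ _ (aut_val g')) E !compmA.
Qed.

Definition gen_hom m n := {f : mor G m n | gen_mor f}.

Definition gen_hom_id n : gen_hom n n := exist _ (idm n) (gen_mor_aut (generated1 n)).

Definition gen_hom_comp m n l (f : gen_hom n l) (f' : gen_hom m n) : gen_hom m l :=
  exist _ (sval f \oc sval f') (gen_mor_comp (svalP f) (svalP f')).

Lemma gen_hom_eq m n (f f' : gen_hom m n) : sval f = sval f' -> f = f'.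
Proof.
by case: f f' => [f Pf] [f' Pf'] /= E; subst f'; rewrite (Prop_irrelevance Pf Pf').
Qed.

Lemma gen_hom_comp1m m n (f : gen_hom m n) : gen_hom_comp (gen_hom_id n) f = f.
Proof. by apply: gen_hom_eq; exact: comp1m. Qed.
Lemma gen_hom_compm1 m n (f : gen_hom m n) : gen_hom_comp f (gen_hom_id m) = f.
Proof. by apply: gen_hom_eq; exact: compm1. Qed.
Lemma gen_hom_compA m n l q (h : gen_hom l q) (g : gen_hom n l) (f : gen_hom m n) :
  gen_hom_comp h (gen_hom_comp g f) = gen_hom_comp (gen_hom_comp h g) f.
Proof. by apply: gen_hom_eq; exact: compmA. Qed.

Definition gen_cat : category nat :=
  Category gen_hom_comp1m gen_hom_compm1 gen_hom_compA.

Definition gen_incl : functor (op gen_cat) (op G) id :=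
  @Functor _ (op gen_cat) _ (op G) id (fun _ _ f => sval f) (fun _ => erefl)
    (fun _ _ _ _ _ => erefl).

Definition gen_emb : functor (op Delta) (op gen_cat) id.
Proof.
exists (fun m n phi => exist _ (emb phi) (gen_mor_emb phi) : mor (op gen_cat) m n).
- by move=> n; apply: gen_hom_eq; exact: fmap_id.
- by move=> m n l g f; apply: gen_hom_eq; exact: fmap_comp.
Defined.

Definition gen_aut n (g : aut G n) (gen_g : generated_aut g)
  (gen_gV : generated_aut g^-1%g) : aut (op gen_cat) n.
Proof.
exists (exist _ (aut_val g) (gen_mor_aut gen_g) : mor (op gen_cat) n n)
  (exist _ (aut_inv g) (gen_mor_aut gen_gV) : mor (op gen_cat) n n).
- by apply: gen_hom_eq; exact: aut_invK.
- by apply: gen_hom_eq; exact: aut_valK.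
Defined.

Definition gen_t n := gen_aut (generated_t n) (generated_tV n).
Definition gen_w (h : has_reflection p) n := gen_aut (generated_w n h) (generated_wV n h).

Lemma gen_aut_incl_inj n : injective (@aut_map _ _ _ _ _ gen_incl n).
Proof.
move=> g h /(congr1 (fun g : aut (op G) n => aut_val g)) E.
by apply: aut_eq; exact: gen_hom_eq.
Qed.

Lemma gen_relations : planar_relations gen_emb gen_t gen_w.
Proof.
have [_ _ further] := rels; split.
- split=> *; apply: gen_hom_eq; first exact: t_coface0.
  + exact: t_coface.
  + exact: t_codegen.
  + exact: t_codegen0.
- move=> h; split=> *; apply: gen_hom_eq; [exact: w_coface | exact: w_codegen].
- apply: (further_relations_faithful gen_aut_incl_inj).
  have -> : (fun n => aut_map gen_incl (gen_t n))
      = (fun n => aut_image (functor_id (op G)) (t n)).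
    by apply/functional_extensionality_dep => n; exact: aut_eq.
  have -> : (fun h n => aut_map gen_incl (gen_w h n))
      = (fun h n => aut_image (functor_id (op G)) (w h n)) => //.
  apply/functional_extensionality_dep => h.
  by apply/functional_extensionality_dep => n; exact: aut_eq.
Qed.

(* The functor given by the presentation from G to its subcategory generated by
   Delta, t and w is a section of the inclusion, by uniqueness. *)
Lemma gen_morP m n (f : mor G m n) : gen_mor f.
Proof.
have [F [[FS Ft Fw] _]] := pl_complete P gen_relations.
have [F' [_ U]] := pl_complete P rels.
suff E : functor_comp gen_incl F = functor_id (op G).
  rewrite (_ : f = @fmap _ _ _ _ _ (functor_id (op G)) n m f) // -E.
  exact: svalP (@fmap _ _ _ _ _ F n m f).
rewrite -(U (functor_id (op G))) //; apply/esym/U; split.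
  - apply: functor_eq => m' n' phi.
    have /= -> // := congr1 (fun S : functor (op Delta) (op gen_cat) id =>
      sval (fmap S phi : gen_hom n' m')) FS.
  - move=> n'; apply: aut_eq.
    have /= -> // := congr1 (fun g : aut (op gen_cat) n' =>
      sval (aut_val g : gen_hom n' n')) (Ft n').
  - move=> h n'; apply: aut_eq.
    have /= -> // := congr1 (fun g : aut (op gen_cat) n' =>
      sval (aut_val g : gen_hom n' n')) (Fw h n').
Qed.

(** The simplicial factor is an endomorphism of $[0]$ in [Delta], hence the identity. *)
Lemma generated_aut0 (g : aut G 0) : generated_aut g.
Proof.
have [phi [g' [gen_g' E]]] := gen_morP (aut_val g).
have phi1 : phi = idm 0 by apply: dhom_eq => j; rewrite [sval phi j]ord1 ord1.
suff -> : g = g' by [].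
by apply: aut_eq; rewrite E phi1 fmap_id comp1m.
Qed.

End Generators.

(** * Parity of t and w *)

Lemma aut_valM O (C : category O) x (g h : aut C x) :
  aut_val (g * h)%g = aut_val g \oc aut_val h.
Proof. by []. Qed.

Section ParityLemmas.
Variable G : crossed_simplicial_group.
Local Notation emb := (fmap (csg_emb G)).

(** [act_mor] and [act_grp] are chosen by [cid]; uniqueness lets any explicit solution of the
    exchange equation compute them. *)
Lemma act_unique m n (phi psi : mor Delta m n) (g : aut G n) (h : aut G m) :
  aut_val g \oc emb psi = emb phi \oc aut_val h ->
  act_mor g phi = psi /\ act_grp phi g = h.
Proof.
move=> E; have [[psi' h'] [_ U]] := csg_exchange phi g.
have [<- <-] := U (psi, h) E.
by have [-> ->] := U (act_mor g phi, act_grp phi g) (act_morE phi g).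
Qed.

(** Commutation with [to_zero n] identifies the pullback of [T 0] to $[n]$ as [T n]; commutation
    with [phi] then says that [T n] fixes [phi]. *)
Lemma even_elt_natural (T : forall n, aut G n) :
  (forall m n (phi : mor Delta m n),
    aut_val (T n) \oc emb phi = emb phi \oc aut_val (T m)) ->
  even_elt (T 0).
Proof.
move=> natT m n phi; rewrite /parity_action.
have [_ ->] := act_unique (natT _ _ (to_zero n)).
exact: (act_unique (natT _ _ phi)).1.
Qed.

(* Reversal swaps the two maps [0] -> [1], so it is not the identity. *)
Lemma odd_elt_reversing (g0 : aut G 0) (g1 : aut G 1) :
  aut_val g0 \oc emb (codegen ord0) = emb (codegen ord0) \oc aut_val g1 ->
  aut_val g1 \oc emb (@coface 0 ord_max) = emb (coface ord0) \oc aut_val g0 ->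
  ~ even_elt g0.
Proof.
move=> E1 E0 /(_ 0 1 (coface ord0)); rewrite /parity_action.
have to_zeroE : to_zero 1 = codegen ord0 by apply: dhom_eq => j; rewrite !ord1.
have [_ ->] : act_mor g0 (to_zero 1) = to_zero 1 /\ act_grp (to_zero 1) g0 = g1.
  by apply: act_unique; rewrite to_zeroE.
have [-> _] := act_unique E0.
by move=> /(congr1 (fun f : dhom 0 1 => nat_of_ord (sval f ord0))); rewrite !cofaceE.
Qed.

End ParityLemmas.

Section Parities.
Variables (G : crossed_simplicial_group) (p : planar_type).
Variable P : planar_presentation p G.
Local Notation emb := (fmap (csg_emb G)).
Local Notation t := (pl_t P).
Local Notation w := (pl_w P).

Lemma tX_coface n j i : j <= i <= n.+1 ->
  aut_val (t n.+1 ^+ j)%g \oc emb (@coface n (inord i))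
    = emb (coface (inord (i - j))) \oc aut_val (t n ^+ j)%g.
Proof.
elim: j => [|j IH] ji; first by rewrite subn0 comp1m compm1.
rewrite !expgS /= -compmA IH; last by lia.
rewrite compmA t_coface; last by lia.
by rewrite -compmA subnS.
Qed.

Lemma tX_codegen n j i : j <= i <= n ->
  aut_val (t n ^+ j)%g \oc emb (@codegen n (inord i))
    = emb (codegen (inord (i - j))) \oc aut_val (t n.+1 ^+ j)%g.
Proof.
elim: j => [|j IH] ji; first by rewrite subn0 comp1m compm1.
rewrite !expgS /= -compmA IH; last by lia.
rewrite compmA t_codegen; last by lia.
by rewrite -compmA subnS.
Qed.

(** On a generator of index $i$ the turn is cut in three: $i$ steps lower the index to 0, one step
    wraps it to the last index, and the rest lower it back to $i$. The wrapping step leaves no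
    letter at a coface and two at a codegeneracy, which accounts for the change of the exponent from
    $n+1$ to $m+1$. *)
Lemma full_turn_natural m n (phi : mor Delta m n) :
  aut_val (t n ^+ n.+1)%g \oc emb phi = emb phi \oc aut_val (t m ^+ m.+1)%g.
Proof.
elim: (simplicial_wordP phi) => {m n phi} [n|n i|n i|m n l psi phi _ IH _ IH'].
- by rewrite fmap_id comp1m compm1.
- have le_i : i <= n.+1 by rewrite -ltnS.
  have -> : n.+2 = (n.+1 - i) + (1 + i) by lia.
  rewrite !expgnDr expg1 /= -!compmA -[X in coface X]inord_val tX_coface ?leqnn //.
  rewrite subnn (_ : inord 0 = ord0); last by apply/val_inj; rewrite /= inordK.
  rewrite (compmA (aut_val (t n.+1))) t_coface0 compmA.
  rewrite (_ : ord_max = inord n.+1); last by apply/val_inj; rewrite /= inordK.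
  rewrite tX_coface ?leq_subr ?leqnn // subKn //.
  by rewrite -compmA -aut_valM -expgnDr subnK.
- have le_i : i <= n by rewrite -ltnS.
  have -> : (t n ^+ n.+1 = t n ^+ (n - i) * (t n * t n ^+ i))%g.
    by rewrite -expgS -expgnDr; congr (_ ^+ _)%g; lia.
  rewrite /= -!compmA -[X in codegen X]inord_val tX_codegen ?leqnn //.
  rewrite subnn (_ : inord 0 = ord0); last by apply/val_inj; rewrite /= inordK.
  rewrite (compmA (aut_val (t n))) t_codegen0 compmA.
  rewrite (_ : ord_max = inord n) ?compmA; last by apply/val_inj; rewrite /= inordK.
  rewrite tX_codegen ?leq_subr ?leqnn // subKn //.
  rewrite -!compmA -!aut_valM -!expgS -expgnDr.
  by congr (_ \oc aut_val (_ ^+ _)%g); lia.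
- by rewrite !fmap_comp compmA IH -compmA IH' compmA.
Qed.

Lemma even_t0V : even_elt (t 0)^-1%g.
Proof.
rewrite -[t 0]expg1.
apply: (@even_elt_natural _ (fun n => (t n ^+ n.+1)^-1%g)) => m n phi.
by apply: inv_exchange; exact: full_turn_natural.
Qed.

Lemma odd_w0V h : ~ even_elt (w h 0)^-1%g.
Proof.
apply: (@odd_elt_reversing _ _ (w h 1)^-1%g); apply: inv_exchange.
  by rewrite w_codegen; congr (fmap _ (codegen _) \oc _); apply/val_inj.
by rewrite w_coface; congr (fmap _ (coface _) \oc _); apply/val_inj.
Qed.

End Parities.

(** * Relations between the operators of $t_0$ and $w_0$ on the algebra *)

Section TwistedOperators.
Variables (k : fieldType) (G : crossed_simplicial_group) (p : planar_type).
Variables (P : planar_presentation p G) (A : unital_algebra k).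
Variable rho : twisted_action G A.
Local Notation t := (pl_t P).
Local Notation w := (pl_w P).

(** Passing from [op G] to [G] reverses products and the inverse reverses them again, so this is a
    left action. *)
Definition op_act (g : aut (op G) 0) (a : A) : A := rho (aut_flip g)^-1%g a.

Lemma op_actM g h a : op_act (g * h)%g a = op_act g (op_act h a).
Proof.
rewrite /op_act (_ : aut_flip (g * h) = aut_flip h * aut_flip g)%g //.
by rewrite invgM (tw_action rho).2.
by apply: aut_eq.
Qed.

Lemma op_act1 a : op_act 1%g a = a.
Proof.
rewrite /op_act (_ : aut_flip 1 = 1)%g; last exact: aut_eq.
by rewrite invg1 (tw_action rho).1.
Qed.

Lemma op_actX g n a : op_act (g ^+ n)%g a = iter n (op_act g) a.
Proof.
elim: n => [|n IH]; first exact: op_act1.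
by rewrite expgS op_actM IH.
Qed.

(** The further relations in degree 0, where the exponent $N(n+1)$ is $N$. The first clause is
    $wtw^{-1}=t^{-1}$ rewritten without inverses. *)
Definition twist_relations (tau : A -> A) (omega : has_reflection p -> A -> A) :
    Prop :=
  (forall h a, tau (omega h (tau a)) = omega h a) /\
  match p with
  | Lambda N => forall a, iter N tau a = a
  | Lambda_oo => True
  | Xi N => (forall a, iter N tau a = a) /\
      forall h a, omega h (omega h a) = a
  | Xi_oo => forall h a, omega h (omega h a) = a
  | Nabla M => forall h a, omega h (omega h a) = iter M tau a /\
      iter 4 (omega h) a = a
  end.

End TwistedOperators.

Lemma dihedral_conj (H : groupType) (x y : H) :
  (y * x * y^-1 = x^-1 -> x * (y * x) = y)%g.
Proof.
by move=> E; rewrite -[(y * x)%g](mulgVK y) /= E mulgA mulgV mul1g.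
Qed.

Lemma twist_relationsP k G p (A : unital_algebra k) (rho : twisted_action G A)
    (t : forall n, aut (op G) n) (w : has_reflection p -> forall n, aut (op G) n) :
  further_relations t w ->
  twist_relations (op_act rho (t 0)) (fun h => op_act rho (w h 0)).
Proof.
have tE N : (t 0 ^+ (N * 1) = 1)%g -> forall a, iter N (op_act rho (t 0)) a = a.
  by move=> E a; rewrite -op_actX -[N]muln1 E op_act1.
have wE h : (w h 0 ^+ 2 = 1)%g ->
    forall a, op_act rho (w h 0) (op_act rho (w h 0) a) = a.
  by move=> E a; rewrite -op_actM -expg2 E op_act1.
have twE h : dihedral_relation t w h -> forall a,
    op_act rho (t 0) (op_act rho (w h 0) (op_act rho (t 0) a))
      = op_act rho (w h 0) a.
  move=> E a; rewrite -!op_actM -mulgA dihedral_conj //; exact: E 0.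
rewrite /further_relations /twist_relations.
case: p w wE twE => [N||N||M] w wE twE; first by split=> //; exact: tE.
- by [].
- move=> [E1 E2]; split=> [h|]; first by have [_ ?] := E2 h; exact: twE.
  by split=> [|h]; [exact: tE | have [? _] := E2 h; exact: wE].
- move=> E2; split=> h; first by have [_ ?] := E2 h; exact: twE.
  by have [? _] := E2 h; exact: wE.
- move=> E2; split=> h a; have [E3 E4 E5] := E2 h; first exact: twE.
  split; first by rewrite -op_actM -expg2 E3 op_actX muln1.
  by rewrite -op_actX E4 op_act1.
Qed.

Lemma op_twist_relations k G p (P : planar_presentation p G)
    (A : unital_algebra k) (rho : twisted_action G A) :
  twist_relations (op_t P rho) (@op_w _ _ _ P _ rho).
Proof.
have [_ _ /(@twist_relationsP k G p A rho)] := pl_sound P (functor_id (op G)).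
suff opE g : op_act rho (aut_image (functor_id (op G)) g) = fun a => rho g^-1%g a.
  by rewrite opE; under [fun h => op_act _ _]eq_fun do rewrite opE.
by apply/funext => a; congr (rho _^-1%g _); exact: aut_eq.
Qed.

(** * The simplicial structure on tuples *)

HB.instance Definition _ (k : fieldType) (A : unital_algebra k) :=
  Monoid.isLaw.Build A (ualg_one A) (@ualg_mul k A)
    (@ualg_mulA k A) (@ualg_mul1 k A) (@ualg_1mul k A).

(** * Monotone maps continued over two periods *)

Section Unroll.
Variables (m n : nat) (phi : mor Delta m n).

(* The map phi continued to two periods, by phi (j + m + 1) = phi j + n + 1. *)
Definition unroll (j : nat) : nat :=
  if j <= m then sval phi (inord j) : nat else sval phi (inord (j - m.+1)) + n.+1.

Lemma unroll_lt j : unroll j < n.+1 + n.+1.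
Proof.
rewrite /unroll; case: ifP => _.
  by have := ltn_ord (sval phi (inord j)); lia.
by have := ltn_ord (sval phi (inord (j - m.+1))); lia.
Qed.

Lemma unroll_mono i j : i <= j < m.+1 + m.+1 -> unroll i <= unroll j.
Proof.
move=> ij; rewrite /unroll; case: (leqP i m) => im; case: (leqP j m) => jm; try lia.
- by apply: (@dhomP _ _ phi); rewrite !inordK //; lia.
- by have := ltn_ord (sval phi (inord i)); lia.
- by rewrite leq_add2r; apply: (@dhomP _ _ phi); rewrite !inordK //; lia.
Qed.

Lemma unroll_period j : j <= m -> unroll (j + m.+1) = unroll j + n.+1.
Proof.
by move=> jm; rewrite /unroll jm addnK ifN // -ltnNge; lia.
Qed.

End Unroll.

Lemma unroll_comp m n l (psi : mor Delta n l) (phi : mor Delta m n) j :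
  unroll (psi \oc phi) j = unroll psi (unroll phi j).
Proof.
rewrite /unroll; case: leqP => jm; rewrite !dhom_compE.
  by rewrite -ltnS ltn_ord inord_val.
by rewrite addnK inord_val ifN // -ltnNge addnS ltnS leq_addl.
Qed.

Lemma unroll_id n j : j < n.+1 + n.+1 -> unroll (idm n) j = j.
Proof.
move=> lt_j; rewrite /unroll; case: leqP => jn.
  by rewrite /= ffunE inordK.
by rewrite /= ffunE inordK; lia.
Qed.

(** * Cyclic products along monotone maps *)

Section Pull.
Variables (k : fieldType) (A : unital_algebra k) (tau : A -> A).
Hypothesis tau1 : tau (ualg_one A) = ualg_one A.
Hypothesis tauM : forall a b : A, tau (a ** b) = tau a ** tau b.

Local Notation "\mprod_ ( i <= j < l ) F" :=
  (\big[@ualg_mul k A/ualg_one A]_(i <= j < l) F)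
  (at level 36, i, j, l at level 50, F at level 36).

(** The tuple is continued as $\tau a_0,\dots,\tau a_n,a_0,\dots,a_n$; the second period is the
    original one, and an entry reached by going back past its start is twisted. *)
Definition unroll_tuple n (a : {ffun 'I_n.+1 -> A}) (i : nat) : A :=
  if i <= n then tau (a (inord i)) else a (inord (i - n.+1)).

(* The product of the a_i with phi (j - 1) < i <= phi j; for j = 0 the interval
   is cyclic and starts with the tau a_i for i > phi m. *)
Definition pull m n (phi : mor Delta m n) (a : {ffun 'I_n.+1 -> A}) :
    {ffun 'I_m.+1 -> A} :=
  [ffun j : 'I_m.+1 => \mprod_((unroll phi (j + m)).+1
     <= i < (unroll phi (j + m.+1)).+1) unroll_tuple a i].

Lemma tau_prod (r s : nat) (F : nat -> A) :
  tau (\mprod_(r <= i < s) F i) = \mprod_(r <= i < s) tau (F i).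
Proof. exact: (big_morph tau tauM tau1). Qed.

(** In the first period [tau] is moved inside the product by multiplicativity. Position 0 is
    excluded: its factor already contains the wrapped entries with one twist and would twist them
    again. *)
Lemma unroll_pull m n (phi : mor Delta m n) a j : 0 < j < m.+1 + m.+1 ->
  unroll_tuple (pull phi a) j
    = \mprod_((unroll phi j.-1).+1 <= i < (unroll phi j).+1) unroll_tuple a i.
Proof.
move=> j_bnd; rewrite {1}/unroll_tuple; case: leqP => jm; rewrite ffunE.
  rewrite inordK // (_ : j + m = j.-1 + m.+1); last by lia.
  rewrite !unroll_period //; last by lia.
  rewrite -!addSn big_addn addnK tau_prod; apply: eq_big_nat => i i_bnd.
  rewrite /unroll_tuple addnK ifN ?ifT //; last by lia.
  by move: i_bnd; rewrite /unroll jm; have := ltn_ord (sval phi (inord j)); lia.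
rewrite inordK; last by lia.
congr (\mprod_(_.+1 <= i < _.+1) _); congr (unroll _ _); lia.
Qed.

Lemma big_telescope (F : nat -> A) (f : nat -> nat) r s : 0 < r <= s ->
  (forall i j, i <= j < s -> f i <= f j) ->
  \mprod_(r <= j < s) \mprod_((f j.-1).+1 <= i < (f j).+1) F i
    = \mprod_((f r.-1).+1 <= i < (f s.-1).+1) F i.
Proof.
move=> /andP[r_gt0]; elim: s => [|s IH] rs f_mono; first by lia.
have [Er|r_neq] := eqVneq r s.+1; first by rewrite Er !big_geq.
rewrite big_nat_recr /=; last by lia.
rewrite IH; [|by lia|by move=> *; apply: f_mono; lia].
rewrite -big_cat_nat //= ltnS; apply: f_mono; lia.
Qed.

(** The left product runs over one interval of the two-period tuple; cutting it at the values of
    [unroll psi] yields the entries of [pull psi a]. The range of indices begins at a successor, so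
    the excluded position 0 does not occur. *)
Lemma pull_comp m n l (psi : mor Delta n l) (phi : mor Delta m n) a :
  pull (psi \oc phi) a = pull phi (pull psi a).
Proof.
apply/ffunP => j; rewrite [RHS]ffunE [LHS]ffunE !unroll_comp.
rewrite -[in LHS](big_telescope _ (r := (unroll phi (j + m)).+1)
  (s := (unroll phi (j + m.+1)).+1)) //=; last first.
- by move=> *; apply: unroll_mono; have := unroll_lt phi (j + m.+1); lia.
- by rewrite ltnS unroll_mono //; have := ltn_ord j; lia.
apply: eq_big_nat => i i_bnd; rewrite unroll_pull //.
by have := unroll_lt phi (j + m.+1); lia.
Qed.

Lemma pull_id n a : pull (idm n) a = a.
Proof.
apply/ffunP => j; rewrite ffunE !unroll_id; try by have := ltn_ord j; lia.
rewrite addnS big_nat1 /unroll_tuple ifN; last by lia.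
by rewrite (_ : _ - _ = j) ?inord_val; last by lia.
Qed.

Lemma pull0 m n (phi : mor Delta m n) a :
  pull phi a ord0 = \mprod_((sval phi ord_max).+1 <= i < n.+1) tau (a (inord i))
     ** \mprod_(0 <= i < (sval phi ord0).+1) a (inord i).
Proof.
rewrite ffunE /= add0n {1}/unroll leqnn add0n {1}/unroll ltnn subnn.
rewrite (_ : inord m = ord_max); last by apply/val_inj; rewrite /= inordK.
rewrite (_ : inord 0 = ord0); last by apply/val_inj; rewrite /= inordK.
have := ltn_ord (sval phi ord_max); have := ltn_ord (sval phi ord0) => lt0 ltm.
rewrite (@big_cat_nat _ _ _ n.+1) //=; last by lia.
congr (_ ** _).
  apply: eq_big_nat => i i_bnd; rewrite /unroll_tuple ifT //; lia.
rewrite -addSn -{1}[n.+1]add0n big_addn addnK; apply: eq_big_nat => i i_bnd.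
by rewrite /unroll_tuple addnK ifN //; lia.
Qed.

Lemma pullS m n (phi : mor Delta m n) a (j : nat) : 0 < j < m.+1 ->
  pull phi a (inord j) =
    \mprod_((sval phi (inord j.-1)).+1 <= i < (sval phi (inord j)).+1)
      a (inord i).
Proof.
move=> j_bnd; rewrite ffunE inordK; last by lia.
rewrite (_ : j + m = j.-1 + m.+1); last by lia.
rewrite !unroll_period; try lia.
rewrite -!addSn big_addn addnK /unroll !ifT; try lia.
apply: eq_big_nat => i i_bnd.
by rewrite /unroll_tuple addnK ifN //; lia.
Qed.

End Pull.

(** * Descent from tuples to tensor powers *)

Section Slotwise.
Variables (k : fieldType) (V W : lmodType k) (n m : nat).
Variable f : {ffun 'I_n -> V} -> {ffun 'I_m -> W}.

(** Multilinearity for maps with values in tuples, where it cannot be stated by addition: varying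
    one entry varies a single entry of the image, linearly. The place [j] and the map [L] may depend
    on the other entries but not on [x]. *)
Definition slotwise : Prop :=
  forall a i, exists j (L : V -> W), linear L /\
    forall x, f (upd a i x) = upd (f a) j (L x).

Hypothesis f_slot : slotwise.

Lemma slotwise_multilinear : multilinear (fun a => tensor (f a)).
Proof.
move=> a i c x y; have [j [L [L_lin E]]] := f_slot a i.
by rewrite !E L_lin tensor_multilinear.
Qed.

Definition slotwise_map : {linear tensor_power V n -> tensor_power W m} :=
  tensor_lift slotwise_multilinear.

Lemma slotwise_mapE a : slotwise_map (tensor a) = tensor (f a).
Proof. exact: tensor_liftE. Qed.

End Slotwise.

Lemma ffun_inordP n (T : Type) (f g : {ffun 'I_n.+1 -> T}) :
  (forall j, j < n.+1 -> f (inord j) = g (inord j)) -> f = g.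
Proof. by move=> fg; apply/ffunP => j; rewrite -[j]inord_val fg. Qed.

Section PullSlotwise.
Variables (k : fieldType) (A : unital_algebra k) (tau : A -> A).
Hypothesis tau_lin : linear tau.
Variables (m n : nat) (phi : mor Delta m n).

(** Together the factors read the positions from $\phi(m)+1$ to $\phi(m)+n+1$, exactly one period,
    so the entry [i] is read once, at [q0]. The factor that reads it is linear in it, being a
    product of fixed elements around [u x]. *)
Lemma pull_slotwise : slotwise (pull tau phi).
Proof.
move=> a i.
have lt_i := ltn_ord i; have lt_max := ltn_ord (sval phi ord_max).
have lo_max : unroll phi m = sval phi ord_max.
  rewrite /unroll leqnn; congr (nat_of_ord (sval phi _)).
  by apply/val_inj; rewrite /= inordK.
have hi_max : unroll phi (m + m.+1) = sval phi ord_max + n.+1.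
  by rewrite unroll_period ?lo_max.
pose q0 := if i <= sval phi ord_max then i + n.+1 else i : nat.
pose u x : A := if i <= sval phi ord_max then x else tau x.
have q0_bnd : sval phi ord_max < q0 <= sval phi ord_max + n.+1.
  by rewrite /q0; case: (leqP i) => ?; lia.
have at_q0 x : unroll_tuple tau (upd a i x) q0 = u x.
  rewrite /unroll_tuple /q0 /u; case: (leqP i) => i_max.
    by rewrite ifN ?addnK ?ffunE ?inord_val ?eqxx //; lia.
  by rewrite ifT ?ffunE ?inord_val ?eqxx //; lia.
have off_q0 x q : sval phi ord_max < q <= sval phi ord_max + n.+1 -> q != q0 ->
    unroll_tuple tau (upd a i x) q = unroll_tuple tau a q.
  move=> q_bnd q_neq; rewrite /unroll_tuple !ffunE.
  have inordE r : r < n.+1 -> (inord r == i) = (r == i :> nat).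
    by move=> lt_r; rewrite -(inj_eq val_inj) /= inordK.
  move: q_neq; rewrite /q0; case: (leqP q n) => qn; case: (leqP i) => i_max q_neq;
    rewrite inordE ?ifN //; lia.
have ex_j : exists j, q0 <= unroll phi (j + m.+1) by exists m; rewrite hi_max; lia.
(* The least [j] whose interval ends at or after [q0] is the factor containing [q0]; minimality puts
   the preceding endpoint before [q0]. *)
have [j hi_j min_j] := ex_minnP ex_j.
have le_j : j <= m by apply: min_j; rewrite hi_max; lia.
have lo_j : unroll phi (j + m) < q0.
  case: j hi_j min_j le_j => [|j] _ min_j _; first by rewrite add0n lo_max; lia.
  by rewrite addSnnS ltnNge; apply/negP => /min_j; rewrite ltnn.
pose pre := \big[@ualg_mul k A/ualg_one A]_((unroll phi (j + m)).+1 <= q < q0)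
  unroll_tuple tau a q.
pose post := \big[@ualg_mul k A/ualg_one A]_(q0.+1 <= q < (unroll phi (j + m.+1)).+1)
  unroll_tuple tau a q.
have range q l : l <= m -> unroll phi (l + m) < q <= unroll phi (l + m.+1) ->
    sval phi ord_max < q <= sval phi ord_max + n.+1.
  move=> lm /andP[lo hi]; apply/andP; split.
    by rewrite -lo_max (leq_ltn_trans _ lo) // unroll_mono //; lia.
  by rewrite -hi_max (leq_trans hi) // unroll_mono //; lia.
exists (inord j), (fun x => pre ** (u x ** post)); split.
  have u_lin : linear u.
    by move=> c x y; rewrite /u; case: ifP => // _; exact: tau_lin.
  by move=> c x y; rewrite u_lin (ualg_linear_l post) (ualg_linear_r pre).
move=> x; apply: ffun_inordP => l lt_l; rewrite [RHS]ffunE.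
rewrite -(inj_eq val_inj) /= !inordK // ffunE [in RHS]ffunE inordK //.
case: eqVneq => [->|l_neq].
  rewrite (@big_cat_nat _ _ _ q0) /=; [|lia|lia].
  rewrite [X in _ ** X]big_ltn; last by lia.
  rewrite at_q0; congr (_ ** (_ ** _)); apply: eq_big_nat => q q_bnd;
    by apply: off_q0; [apply: (range _ j); lia | lia].
apply: eq_big_nat => q q_bnd; apply: off_q0; first by apply: (range _ l); lia.
case: (ltngtP l j) l_neq => // lj _.
  have : unroll phi (l + m.+1) <= unroll phi (j + m) by apply: unroll_mono; lia.
  by lia.
have : unroll phi (j + m.+1) <= unroll phi (l + m) by apply: unroll_mono; lia.
by lia.
Qed.

End PullSlotwise.

(** * Agreement with the Hochschild faces and degeneracies *)

Section PullFormulas.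
Variables (k : fieldType) (A : unital_algebra k) (tau : A -> A).

Lemma face_funE n (i : 'I_n.+1) (a : {ffun 'I_n.+2 -> A}) j : j < n.+1 ->
  face_fun i a (inord j) = if j < i then a (inord j)
    else if j == i then a (inord i) ** a (inord i.+1) else a (inord j.+1).
Proof. by move=> lt_j; rewrite ffunE -(inj_eq val_inj) /= inordK. Qed.

Lemma last_face_funE n (a : {ffun 'I_n.+2 -> A}) j : j < n.+1 ->
  last_face_fun tau a (inord j) =
    if j == 0 then tau (a (inord n.+1)) ** a (inord 0) else a (inord j).
Proof.
move=> lt_j; rewrite ffunE -(inj_eq val_inj) /= inordK //.
by congr (if _ then tau (a _) ** a _ else _); apply/val_inj; rewrite /= inordK.
Qed.

Lemma degen_funE n (i : 'I_n.+1) (a : {ffun 'I_n.+1 -> A}) j : j < n.+2 ->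
  degen_fun i a (inord j) = if j <= i then a (inord j)
    else if j == i.+1 then ualg_one A else a (inord j.-1).
Proof. by move=> lt_j; rewrite ffunE /= inordK. Qed.

Lemma rotation_funE n (a : {ffun 'I_n.+1 -> A}) j : j < n.+1 ->
  rotation_fun tau a (inord j) =
    if j == 0 then tau (a (inord n)) else a (inord j.-1).
Proof.
move=> lt_j; rewrite ffunE -(inj_eq val_inj) /= inordK //.
by congr (if _ then tau (a _) else _); apply/val_inj; rewrite /= inordK.
Qed.

Lemma reflection_funE (omega : A -> A) n (a : {ffun 'I_n.+1 -> A}) j : j < n.+1 ->
  reflection_fun tau omega a (inord j) =
    if j == 0 then omega (a (inord 0)) else omega (tau (a (inord (n.+1 - j)))).
Proof.
move=> lt_j; rewrite ffunE -(inj_eq val_inj) /= inordK //.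
by congr (if _ then omega (a _) else _); apply/val_inj; rewrite /= inordK.
Qed.

Lemma inord0E n : inord 0 = ord0 :> 'I_n.+1.
Proof. by apply/val_inj; rewrite /= inordK. Qed.

Lemma coface_inordE n i j : i < n.+2 -> j < n.+1 ->
  sval (@coface n (inord i)) (inord j) = (if j < i then j else j.+1) :> nat.
Proof. by move=> lt_i lt_j; rewrite cofaceE !inordK. Qed.

Lemma pull_coface n (i : 'I_n.+1) a :
  pull tau (coface (lift ord_max i)) a = face_fun i a.
Proof.
have -> : lift ord_max i = inord i.
  by apply/val_inj; rewrite [LHS]lift_max /= inordK // ltnW // ltnS.
have lt_i := ltn_ord i.
apply: ffun_inordP => j lt_j; rewrite face_funE //.
have [->|j_gt0] := posnP j.
  rewrite inord0E pull0 !cofaceE inordK //=; last by lia.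
  rewrite ifN; last by lia.
  rewrite big_geq // Monoid.mul1m; case: posnP => [-> | i_gt0].
    by rewrite big_ltn // big_nat1.
  by rewrite big_nat1.
rewrite pullS ?j_gt0 // !coface_inordE; try lia.
case: (ltngtP j i) => ji.
- by rewrite ifT ?prednK ?big_nat1 //; lia.
- by rewrite ifN ?prednK ?big_nat1 //; lia.
- have i_gt0 : 0 < i by rewrite -ji.
  by rewrite ji ltn_predL i_gt0 prednK // big_ltn // big_nat1.
Qed.

Lemma pull_last_coface n (a : {ffun 'I_n.+2 -> A}) :
  pull tau (@coface n ord_max) a = last_face_fun tau a.
Proof.
apply: ffun_inordP => j lt_j; rewrite last_face_funE //.
have [->|j_gt0] := posnP j.
  by rewrite inord0E pull0 !cofaceE /= ltnSn big_nat1 big_nat1.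
rewrite pullS ?j_gt0 // !cofaceE !inordK /=; try lia.
by rewrite !ifT ?prednK ?big_nat1 //; lia.
Qed.

Lemma pull_codegen n (i : 'I_n.+1) (a : {ffun 'I_n.+1 -> A}) :
  pull tau (codegen i) a = degen_fun i a.
Proof.
have lt_i := ltn_ord i.
apply: ffun_inordP => j lt_j; rewrite degen_funE //.
have [->|j_gt0] := posnP j.
  rewrite inord0E pull0 !codegenE /= ifN; last by lia.
  by rewrite big_geq // Monoid.mul1m big_nat1.
rewrite pullS ?j_gt0 // !codegenE !inordK /=; try lia.
case: (ltngtP j i.+1) => ji.
- have [-> ->] : (j.-1 <= i)%N /\ (j <= i)%N by lia.
  by rewrite prednK // big_nat1.
- have [-> ->] : (j.-1 <= i)%N = false /\ (j <= i)%N = false by lia.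
  by rewrite prednK ?big_nat1 //; lia.
- have [-> ->] : (j.-1 <= i)%N /\ (j <= i)%N = false by lia.
  by rewrite big_geq.
Qed.

End PullFormulas.

(** * Cyclic and dihedral relations on tuples *)

Ltac simp_ifs :=
  repeat first [rewrite ifT; last by lia | rewrite ifN; last by lia].

Section TupleRelations.
Variables (k : fieldType) (A : unital_algebra k) (tau : A -> A).
Hypothesis tau1 : tau (ualg_one A) = ualg_one A.
Hypothesis tauM : forall a b : A, tau (a ** b) = tau a ** tau b.

Local Notation d i := (pull tau (coface i)).
Local Notation s i := (pull tau (codegen i)).
Local Notation rot := (rotation_fun tau).

Lemma ord_maxE n : ord_max = inord n :> 'I_n.+1.
Proof. by apply/val_inj; rewrite /= inordK. Qed.

Lemma pull_cofaceE n i (a : {ffun 'I_n.+2 -> A}) j : i <= n -> j < n.+1 ->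
  d (inord i) a (inord j) = if j < i then a (inord j)
    else if j == i then a (inord i) ** a (inord i.+1) else a (inord j.+1).
Proof.
move=> le_i lt_j; have E : inord i = lift ord_max (inord i : 'I_n.+1).
  by apply/val_inj; rewrite [RHS]lift_max /= !inordK // ltnS ltnW.
by rewrite [X in coface X]E pull_coface face_funE // inordK.
Qed.

Lemma pull_coface_maxE n (a : {ffun 'I_n.+2 -> A}) j : j < n.+1 ->
  d (inord n.+1) a (inord j) =
    if j == 0 then tau (a (inord n.+1)) ** a (inord 0) else a (inord j).
Proof.
move=> lt_j.
by rewrite -[X in coface X]ord_maxE pull_last_coface last_face_funE.
Qed.

Lemma pull_codegenE n i (a : {ffun 'I_n.+1 -> A}) j : i < n.+1 -> j < n.+2 ->
  s (inord i) a (inord j) = if j <= i then a (inord j)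
    else if j == i.+1 then ualg_one A else a (inord j.-1).
Proof. by move=> lt_i lt_j; rewrite pull_codegen degen_funE // inordK. Qed.

Lemma rot_coface0 n (a : {ffun 'I_n.+2 -> A}) : d ord0 (rot a) = d ord_max a.
Proof.
apply: ffun_inordP => j lt_j; rewrite -inord0E ord_maxE pull_cofaceE //.
by rewrite pull_coface_maxE // !rotation_funE // ltnW.
Qed.

Lemma rot_coface n i (a : {ffun 'I_n.+2 -> A}) : 1 <= i <= n.+1 ->
  d (inord i) (rot a) = rot (d (inord i.-1) a).
Proof.
move=> i_bnd; apply: ffun_inordP => j lt_j; rewrite rotation_funE //.
(* Only the last face needs multiplicativity of [tau]: its factor 0 is $\tau(a_n)\tau(a_{n+1})$ on
   the left and $\tau(a_na_{n+1})$ on the right. *)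
have [->|i_neq] := eqVneq i n.+1.
  rewrite pull_coface_maxE // !rotation_funE //; try lia.
  case: (posnP j) => [_|j_gt0] /=; rewrite pull_cofaceE //; try lia.
    by rewrite ltnn eqxx tauM.
  by rewrite ifT //; lia.
rewrite !pull_cofaceE //; try lia.
case: (posnP j) => [->|j_gt0].
  by rewrite rotation_funE //; simp_ifs.
rewrite !rotation_funE //; try lia.
case: (ltngtP j i) => ji; simp_ifs => //; first by rewrite prednK.
by rewrite prednK //; lia.
Qed.

Lemma rot_codegen n i (a : {ffun 'I_n.+1 -> A}) : 1 <= i <= n ->
  s (inord i) (rot a) = rot (s (inord i.-1) a).
Proof.
move=> i_bnd; apply: ffun_inordP => j lt_j; rewrite rotation_funE //.
rewrite !pull_codegenE //; try lia.
case: (posnP j) => [->|j_gt0].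
  by rewrite leq0n rotation_funE //; simp_ifs.
by case: (ltngtP j i.+1) => ji; simp_ifs => //;
  rewrite rotation_funE; try lia; simp_ifs.
Qed.

(** The unit inserted at the end comes to the front as $\tau(1)$ and is then shifted to place 1,
    whence the second rotation. *)
Lemma rot_codegen0 n (a : {ffun 'I_n.+1 -> A}) :
  s ord0 (rot a) = rot (rot (s ord_max a)).
Proof.
apply: ffun_inordP => j lt_j; rewrite -inord0E ord_maxE !rotation_funE //; try lia.
rewrite !pull_codegenE //; try lia.
rewrite ltnn eqxx.
case: j lt_j => [|[|j]] lt_j /=.
- by rewrite rotation_funE ?leqnn.
- by rewrite tau1.
- by rewrite rotation_funE; [simp_ifs | lia].
Qed.

Lemma iter_rot n r (a : {ffun 'I_n.+1 -> A}) j : r <= n.+1 -> j < n.+1 ->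
  iter r rot a (inord j) =
    if j < r then tau (a (inord (n.+1 + j - r))) else a (inord (j - r)).
Proof.
elim: r j => [|r IH] j le_r lt_j; first by rewrite ltn0 subn0.
rewrite iterS rotation_funE // !IH //; try lia.
case: j lt_j => [|j] lt_j /=.
  by rewrite ifN; [congr (tau (a (inord _))); lia | lia].
rewrite ltnS; case: ltnP => jr; last by rewrite subSS.
by congr (tau (a (inord _))); lia.
Qed.

(** In a full turn each entry passes from the last place to the first exactly once. *)
Lemma iter_full_rot n (a : {ffun 'I_n.+1 -> A}) :
  iter n.+1 rot a = [ffun j => tau (a j)].
Proof.
apply: ffun_inordP => j lt_j; rewrite iter_rot // lt_j ffunE.
by rewrite addKn.
Qed.

Lemma iter_full_rotX n N (a : {ffun 'I_n.+1 -> A}) :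
  iter (N * n.+1) rot a = [ffun j => iter N tau (a j)].
Proof.
elim: N => [|N IH]; first by apply/ffunP => j; rewrite ffunE.
rewrite mulSn iterD IH iter_full_rot.
by apply/ffunP => j; rewrite !ffunE.
Qed.

Section Reflection.
Variable omega : A -> A.
Hypothesis omega1 : omega (ualg_one A) = ualg_one A.
Hypothesis omegaM : forall a b : A, omega (a ** b) = omega b ** omega a.
Hypothesis tau_omega_tau : forall a, tau (omega (tau a)) = omega a.

Local Notation refl := (reflection_fun tau omega).

Lemma refl_coface n i (a : {ffun 'I_n.+2 -> A}) :
  d i (refl a) = refl (d (rev_ord i) a).
Proof.
have lt_i := ltn_ord i.
have -> : rev_ord i = inord (n.+1 - i).
  by apply/val_inj; rewrite /= inordK ?subSS //; lia.
rewrite -{1}[i]inord_val; move: (nat_of_ord i) lt_i => {}i lt_i.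
apply: ffun_inordP => j lt_j; rewrite reflection_funE //.
(* At the last face the factor 0 is
   $\tau\omega\tau(a_1)\,\omega(a_0)=\omega(a_1)\omega(a_0)=\omega(a_0a_1)$, the reflected face
   0. *)
have [->|i_neq] := eqVneq i n.+1.
  rewrite pull_coface_maxE // subnn !reflection_funE //; try lia.
  case: (posnP j) => [_|j_gt0] /=; rewrite pull_cofaceE //; try lia.
    by rewrite ltnn eqxx omegaM tau_omega_tau subSnn.
  by rewrite ifN ?ifN; try lia; congr (omega (tau (a (inord _)))); lia.
rewrite pull_cofaceE //; last by lia.
(* Conversely, face 0 gives $\omega(a_0)\,\omega(\tau a_{n+1})=\omega(\tau(a_{n+1})a_0)$, the
   reflected last face. *)
have [->|i_gt0] := posnP i; have [->|j_gt0] := posnP j.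
- rewrite subn0 pull_coface_maxE // !reflection_funE //.
  by simp_ifs; rewrite omegaM subn1.
- rewrite subn0 pull_coface_maxE; last by lia.
  by rewrite ltn0 reflection_funE; [simp_ifs; rewrite subSS | lia].
- rewrite pull_cofaceE; try lia.
  by simp_ifs; rewrite reflection_funE.
rewrite pull_cofaceE; try lia.
case: (ltngtP j i) => ji; simp_ifs.
- rewrite reflection_funE; last by lia.
  by simp_ifs; congr (omega (tau (a (inord _)))); lia.
- rewrite reflection_funE; last by lia.
  by simp_ifs; congr (omega (tau (a (inord _)))); lia.
- rewrite !reflection_funE; try lia.
  simp_ifs; rewrite tauM omegaM.
  by congr (omega (tau (a (inord _))) ** omega (tau (a (inord _)))); lia.
Qed.

Lemma refl_codegen n i (a : {ffun 'I_n.+1 -> A}) :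
  s i (refl a) = refl (s (rev_ord i) a).
Proof.
have lt_i := ltn_ord i.
have -> : rev_ord i = inord (n - i).
  by apply/val_inj; rewrite /= inordK ?subSS //; lia.
rewrite -{1}[i]inord_val; move: (nat_of_ord i) lt_i => {}i lt_i.
apply: ffun_inordP => j lt_j; rewrite reflection_funE //.
rewrite pull_codegenE //; try lia.
have [->|j_gt0] := posnP j.
  by rewrite pull_codegenE ?reflection_funE //; lia.
rewrite pull_codegenE; try lia.
case: (ltngtP j i.+1) => ji; simp_ifs.
- rewrite reflection_funE; last by lia.
  by simp_ifs; congr (omega (tau (a (inord _)))); lia.
- rewrite reflection_funE; last by lia.
  by simp_ifs; congr (omega (tau (a (inord _)))); lia.
- by rewrite tau1 omega1.
Qed.

(** The dihedral relation in a form free of inverses, which can be checked entry by entry. *)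
Lemma rot_refl_rot n (a : {ffun 'I_n.+1 -> A}) : rot (refl (rot a)) = refl a.
Proof.
apply: ffun_inordP => j lt_j; rewrite rotation_funE // [RHS]reflection_funE //.
have [_|j_gt0] := posnP j.
  case: n a lt_j => [|n] a _; rewrite reflection_funE //=.
    by rewrite rotation_funE // tau_omega_tau.
  by rewrite subSnn rotation_funE // tau_omega_tau.
rewrite reflection_funE; last by lia.
have [j1|j1] := posnP j.-1.
  by rewrite rotation_funE //= (_ : n.+1 - j = n) //; lia.
rewrite rotation_funE; last by lia.
by simp_ifs; congr (omega (tau (a (inord _)))); lia.
Qed.

(** Taking [omega'] equal to [omega] gives the square of the reflection; taking it inverse to
    [omega] shows that the reflection is invertible. *)
Lemma reflK_fun (omega' : A -> A) n (a : {ffun 'I_n.+1 -> A}) :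
  reflection_fun tau omega' (refl a) = [ffun j => omega' (omega (a j))].
Proof.
apply: ffun_inordP => j lt_j; rewrite [RHS]ffunE reflection_funE //.
have [->|j_gt0] := posnP j; first by rewrite reflection_funE.
rewrite reflection_funE; last by lia.
by simp_ifs; rewrite tau_omega_tau subKn // ltnW.
Qed.

End Reflection.

End TupleRelations.

(** * Rotations and reflections: inverses and linearity in each entry *)

Section CyclicSlotwise.
Variables (k : fieldType) (A : unital_algebra k) (tau tauV omega : {linear A -> A}).
Hypotheses (tauK : cancel tau tauV) (tauVK : cancel tauV tau).
Variable n : nat.
Implicit Types (a : {ffun 'I_n.+1 -> A}) (i : 'I_n.+1).

Definition unrotation_fun a : {ffun 'I_n.+1 -> A} :=
  [ffun j : 'I_n.+1 => if j == ord_max then tauV (a ord0) else a (inord j.+1)].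

Lemma unrotation_funE a j : j < n.+1 ->
  unrotation_fun a (inord j) =
    if j == n then tauV (a (inord 0)) else a (inord j.+1).
Proof.
by move=> lt_j; rewrite ffunE -(inj_eq val_inj) /= inordK // inord0E.
Qed.

Lemma rotationK a : unrotation_fun (rotation_fun tau a) = a.
Proof.
apply: ffun_inordP => j lt_j; rewrite unrotation_funE // rotation_funE //=.
have [->|j_neq] := eqVneq j n; first exact: tauK.
by rewrite rotation_funE //; lia.
Qed.

Lemma unrotationK a : rotation_fun tau (unrotation_fun a) = a.
Proof.
apply: ffun_inordP => j lt_j; rewrite rotation_funE // unrotation_funE //.
rewrite eqxx tauVK; have [->//|j_gt0] := posnP j.
rewrite unrotation_funE; last by lia.
by rewrite ifN ?prednK //; lia.
Qed.

Lemma upd_inordE (B : lmodType k) m (b : {ffun 'I_m.+1 -> B}) (i : 'I_m.+1) x j :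
  j < m.+1 -> upd b i x (inord j) = if j == i then x else b (inord j).
Proof. by move=> lt_j; rewrite ffunE -(inj_eq val_inj) /= inordK. Qed.

Lemma rotation_slotwise : slotwise (@rotation_fun k A n tau).
Proof.
move=> a i; have lt_i := ltn_ord i.
have [i_max|i_neq] := eqVneq (i : nat) n.
  exists ord0, tau; split=> [|x]; first exact: linearP.
  apply: ffun_inordP => j lt_j; rewrite upd_inordE // !rotation_funE //.
  rewrite upd_inordE // i_max eqxx; have [_//|j_gt0] := posnP j.
  by rewrite upd_inordE ?ifN ?i_max //; lia.
exists (inord i.+1), id; split=> // x.
apply: ffun_inordP => j lt_j; rewrite upd_inordE //.
rewrite !rotation_funE // inordK; last by lia.
rewrite upd_inordE // [n == _]eq_sym (negbTE i_neq).
have [->//|j_gt0] := posnP j.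
rewrite upd_inordE; last by lia.
by rewrite (_ : (j.-1 == i) = (j == i.+1)) //; lia.
Qed.

Lemma unrotation_slotwise : slotwise unrotation_fun.
Proof.
move=> a i; have lt_i := ltn_ord i.
have [i0|i_gt0] := posnP i.
  exists ord_max, tauV; split=> [|x]; first exact: linearP.
  apply: ffun_inordP => j lt_j; rewrite upd_inordE // !unrotation_funE //.
  rewrite upd_inordE // i0 eqxx /=; have [_//|j_neq] := eqVneq j n.
  by rewrite upd_inordE ?i0 //; lia.
exists (inord i.-1), id; split=> // x.
apply: ffun_inordP => j lt_j; rewrite upd_inordE //.
rewrite !unrotation_funE // inordK; last by lia.
rewrite upd_inordE // (_ : (0 == i) = false); last by lia.
have [->|j_neq] := eqVneq j n; first by rewrite ifN //; lia.
rewrite upd_inordE; last by lia.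
by rewrite (_ : (j == i.-1) = (j.+1 == i)) //; lia.
Qed.

Lemma reflection_slotwise : slotwise (@reflection_fun k A n tau omega).
Proof.
move=> a i; have lt_i := ltn_ord i.
have [i0|i_gt0] := posnP i.
  exists ord0, omega; split=> [|x]; first exact: linearP.
  apply: ffun_inordP => j lt_j; rewrite upd_inordE // !reflection_funE //.
  rewrite upd_inordE // i0 eqxx /=; have [_//|j_gt0] := posnP j.
  by rewrite upd_inordE ?ifN ?i0 //; lia.
exists (inord (n.+1 - i)), (omega \o tau); split=> [|x]; first exact: linearP.
apply: ffun_inordP => j lt_j; rewrite upd_inordE //.
rewrite !reflection_funE // inordK; last by lia.
rewrite upd_inordE // (_ : (0 == i) = false); last by lia.
have [->|j_gt0] := posnP j; first by rewrite ifN //; lia.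
rewrite upd_inordE; last by lia.
by rewrite (_ : (n.+1 - j == i) = (j == n.+1 - i)); [case: eqP | lia].
Qed.

End CyclicSlotwise.

(** * The planar object of tensor powers *)

Section ActsBy.
Variables (k : fieldType).
Implicit Types V W U : lmodType k.

(** Pure tensors span, so a linear map is determined by any map of tuples that represents it, and
    identities of linear maps become identities of tuples. *)
Definition acts_by V W n m (f : {linear tensor_power V n -> tensor_power W m})
    (u : {ffun 'I_n -> V} -> {ffun 'I_m -> W}) : Prop :=
  forall a, f (tensor a) = tensor (u a).

Lemma acts_by_comp U V W n m l
    (g : {linear tensor_power V m -> tensor_power W l}) v
    (f : {linear tensor_power U n -> tensor_power V m}) u :
  acts_by g v -> acts_by f u -> acts_by (vect_comp g f) (v \o u).
Proof. by move=> gv fu a; rewrite /= fu gv. Qed.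

Lemma acts_by_eq V W n m (f g : {linear tensor_power V n -> tensor_power W m}) u v :
  acts_by f u -> acts_by g v -> u =1 v -> f = g.
Proof.
by move=> fu gv uv; apply/linear_eq/tensor_span => a; rewrite fu gv uv.
Qed.

Lemma acts_by_id V n : acts_by (vect_id (tensor_power V n)) id.
Proof. by []. Qed.

Definition acts_by_aut V n (f : aut (Vect k) (tensor_power V n)) u : Prop :=
  acts_by (aut_val f : {linear tensor_power V n -> tensor_power V n}) u.

Lemma acts_by_aut1 V n : acts_by_aut (1%g : aut (Vect k) (tensor_power V n)) id.
Proof. by []. Qed.

Lemma acts_by_autM V n (f g : aut (Vect k) (tensor_power V n)) u v :
  acts_by_aut f u -> acts_by_aut g v -> acts_by_aut (f * g)%g (u \o v).
Proof. exact: acts_by_comp. Qed.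

Lemma acts_by_autX V n (f : aut (Vect k) (tensor_power V n)) u r :
  acts_by_aut f u -> acts_by_aut (f ^+ r)%g (iter r u).
Proof.
move=> fu; elim: r => [|r IH]; first by move=> a.
by rewrite expgS; move=> a; rewrite (acts_by_autM fu IH).
Qed.

Lemma acts_by_aut_eq V n (f g : aut (Vect k) (tensor_power V n)) u v :
  acts_by_aut f u -> acts_by_aut g v -> u =1 v -> f = g.
Proof. by move=> fu gv uv; apply: aut_eq; exact: acts_by_eq fu gv uv. Qed.

Definition slotwise_aut V n (u v : {ffun 'I_n -> V} -> {ffun 'I_n -> V})
  (u_slot : slotwise u) (v_slot : slotwise v) (uK : cancel u v) (vK : cancel v u) :
  aut (Vect k) (tensor_power V n).
Proof.
exists (slotwise_map u_slot : mor (Vect k) _ _) (slotwise_map v_slot).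
- apply: (acts_by_eq (acts_by_comp (slotwise_mapE v_slot) (slotwise_mapE u_slot))
    (acts_by_id (V := V) (n := n))); exact: uK.
- apply: (acts_by_eq (acts_by_comp (slotwise_mapE u_slot) (slotwise_mapE v_slot))
    (acts_by_id (V := V) (n := n))); exact: vK.
Defined.

Lemma slotwise_autE V n u v u_slot v_slot uK vK :
  acts_by_aut (@slotwise_aut V n u v u_slot v_slot uK vK) u.
Proof. exact: slotwise_mapE. Qed.

End ActsBy.

(** Confines the case analysis on the planar type: it is enough to know how each single identity of
    [tau] and [omega] passes to the automorphisms. *)
Lemma further_relations_tensor (k : fieldType) (A : unital_algebra k) p
    (tau : A -> A) (omega : has_reflection p -> A -> A)
    (t : forall n, aut (Vect k) (hochschild A n))
    (w : has_reflection p -> forall n, aut (Vect k) (hochschild A n)) :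
  (forall N n, (forall a, iter N tau a = a) -> t n ^+ (N * n.+1) = 1)%g ->
  (forall h n, (forall a, omega h (omega h a) = a) -> w h n ^+ 2 = 1)%g ->
  (forall h n, (forall a, iter 4 (omega h) a = a) -> w h n ^+ 4 = 1)%g ->
  (forall h n N, (forall a, omega h (omega h a) = iter N tau a) ->
    w h n ^+ 2 = t n ^+ (N * n.+1))%g ->
  (forall h, dihedral_relation t w h) ->
  twist_relations tau omega -> further_relations t w.
Proof.
move=> tN w2 w4 w2t dih [_]; rewrite /further_relations.
case: p omega w w2 w4 w2t dih => [N||N||M] omega w w2 w4 w2t dih.
- by move=> E n; exact: tN.
- by [].
- move=> [E1 E2]; split=> [n|h]; first exact: tN.
  by split=> [n|]; [apply: w2; exact: E2 | exact: dih].
- by move=> E h; split=> [n|]; [apply: w2; exact: E | exact: dih].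
- move=> E h; split=> [n|n|]; last exact: dih.
    by apply: w2t => a; exact: (E h a).1.
  by apply: w4 => a; exact: (E h a).2.
Qed.

Section HochschildData.
Variables (k : fieldType) (A : unital_algebra k) (p : planar_type).
Variables tau tauV : {linear A -> A}.
Variables omega omegaV : has_reflection p -> {linear A -> A}.
Hypotheses (tauK : cancel tau tauV) (tauVK : cancel tauV tau).
Hypotheses (omegaK : forall h, cancel (omega h) (omegaV h)).
Hypotheses (omegaVK : forall h, cancel (omegaV h) (omega h)).
Hypothesis tau1 : tau (ualg_one A) = ualg_one A.
Hypothesis tauM : forall a b : A, tau (a ** b) = tau a ** tau b.
Hypothesis omega1 : forall h, omega h (ualg_one A) = ualg_one A.
Hypothesis omegaM : forall h a b, omega h (a ** b) = omega h b ** omega h a.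
Hypothesis twist : twist_relations tau (fun h => omega h).

Definition hoch_simplicial : functor (op Delta) (Vect k) (hochschild A).
Proof.
exists (fun m n (phi : mor (op Delta) m n) =>
  slotwise_map (pull_slotwise (linearP tau) (phi : mor Delta n m))
    : mor (Vect k) (hochschild A m) (hochschild A n)).
- move=> n; apply: (acts_by_eq (slotwise_mapE _) (acts_by_id (V := A) (n := n.+1))).
  exact: pull_id.
- move=> m n l psi phi.
  apply: (acts_by_eq (slotwise_mapE _)
    (acts_by_comp (slotwise_mapE _) (slotwise_mapE _))).
  exact: pull_comp.
Defined.

Lemma hoch_simplicialE m n (phi : mor Delta m n) :
  acts_by (fmap hoch_simplicial (phi : mor (op Delta) n m)) (pull tau phi).
Proof. exact: slotwise_mapE. Qed.

Definition hoch_t n : aut (Vect k) (hochschild A n) :=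
  slotwise_aut (rotation_slotwise tau (n := n)) (unrotation_slotwise tauV (n := n))
    (rotationK tauK (n := n)) (unrotationK tauVK (n := n)).

Lemma hoch_w_subproof (h : has_reflection p) n :
  cancel (@reflection_fun k A n tau (omega h)) (reflection_fun tau (omegaV h)).
Proof.
move=> a; rewrite reflK_fun //; last exact: (twist.1 h).
by apply/ffunP => j; rewrite ffunE omegaK.
Qed.

Lemma hoch_w_subproofV (h : has_reflection p) n :
  cancel (@reflection_fun k A n tau (omegaV h)) (reflection_fun tau (omega h)).
Proof.
move=> a; rewrite reflK_fun //.
  by apply/ffunP => j; rewrite ffunE omegaVK.
(* The relation $\tau\omega\tau=\omega$ passes to the inverse of [omega]: after applying [omega] and
   then [tau], both sides become $\tau x$. *)
move=> x; apply: (can_inj (omegaK h)); apply: (can_inj tauK).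
by rewrite (twist.1 h) !omegaVK.
Qed.

Definition hoch_w (h : has_reflection p) n : aut (Vect k) (hochschild A n) :=
  slotwise_aut (reflection_slotwise tau (omega h) (n := n))
    (reflection_slotwise tau (omegaV h) (n := n))
    (hoch_w_subproof h (n := n)) (hoch_w_subproofV h (n := n)).

Lemma hoch_tE n : acts_by_aut (hoch_t n) (rotation_fun tau).
Proof. exact: slotwise_autE. Qed.

Lemma hoch_wE h n : acts_by_aut (hoch_w h n) (reflection_fun tau (omega h)).
Proof. exact: slotwise_autE. Qed.

Lemma hoch_tX n N :
  acts_by_aut (hoch_t n ^+ (N * n.+1))%g (fun a => [ffun j => iter N tau (a j)]).
Proof.
by move=> a; rewrite (acts_by_autX _ (hoch_tE (n := n))) iter_full_rotX.
Qed.

Lemma hoch_w2 h n :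
  acts_by_aut (hoch_w h n ^+ 2)%g (fun a => [ffun j => omega h (omega h (a j))]).
Proof.
move=> a; rewrite (acts_by_autX _ (hoch_wE h (n := n))) /= reflK_fun //.
exact: (twist.1 h).
Qed.

Lemma hoch_tX1 N n : (forall a, iter N tau a = a) -> (hoch_t n ^+ (N * n.+1) = 1)%g.
Proof.
move=> tauN; apply: (acts_by_aut_eq (@hoch_tX n N) (@acts_by_aut1 k A n.+1)) => a.
by apply/ffunP => j; rewrite ffunE tauN.
Qed.

Lemma hoch_w21 h n : (forall a, omega h (omega h a) = a) -> (hoch_w h n ^+ 2 = 1)%g.
Proof.
move=> omega2; apply: (acts_by_aut_eq (@hoch_w2 h n) (@acts_by_aut1 k A n.+1)) => a.
by apply/ffunP => j; rewrite ffunE omega2.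
Qed.

Lemma hoch_w41 h n : (forall a, iter 4 (omega h) a = a) -> (hoch_w h n ^+ 4 = 1)%g.
Proof.
move=> omega4; rewrite -[4]/(2 * 2) expgnA.
apply: (acts_by_aut_eq (acts_by_autX 2 (@hoch_w2 h n))
  (@acts_by_aut1 k A n.+1)) => a.
by apply/ffunP => j; rewrite /= !ffunE; exact: omega4.
Qed.

Lemma hoch_w2tX h n N : (forall a, omega h (omega h a) = iter N tau a) ->
  (hoch_w h n ^+ 2 = hoch_t n ^+ (N * n.+1))%g.
Proof.
move=> omega2; apply: (acts_by_aut_eq (@hoch_w2 h n) (@hoch_tX n N)) => a.
by apply/ffunP => j; rewrite !ffunE omega2.
Qed.

Lemma hoch_dihedral h n :
  (hoch_w h n * hoch_t n * (hoch_w h n)^-1 = (hoch_t n)^-1)%g.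
Proof.
have E : (hoch_t n * (hoch_w h n * hoch_t n) = hoch_w h n)%g.
  have tE := hoch_tE (n := n); have wE := hoch_wE h (n := n).
  apply: (acts_by_aut_eq (acts_by_autM tE (acts_by_autM wE tE)) wE) => a /=.
  exact: (rot_refl_rot (twist.1 h)).
by rewrite -{2}E invgM mulgA mulgV mul1g.
Qed.

Lemma hoch_relations : planar_relations hoch_simplicial hoch_t hoch_w.
Proof.
have dE n i : acts_by (sface hoch_simplicial i) (pull tau (@coface n i)).
  exact: hoch_simplicialE.
have sE n i : acts_by (sdegen hoch_simplicial i) (pull tau (@codegen n i)).
  exact: hoch_simplicialE.
have tE n := hoch_tE (n := n); have wE h n := hoch_wE h (n := n).
split.
- split.
  + move=> n; apply: (acts_by_eq (acts_by_comp (dE _ _) (tE _)) (dE _ _)) => a.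
    exact: rot_coface0.
  + move=> n i i_bnd.
    apply: (acts_by_eq (acts_by_comp (dE _ _) (tE _))
      (acts_by_comp (tE _) (dE _ _))) => a.
    exact: rot_coface.
  + move=> n i i_bnd.
    apply: (acts_by_eq (acts_by_comp (sE _ _) (tE _))
      (acts_by_comp (tE _) (sE _ _))) => a.
    exact: rot_codegen.
  + move=> n.
    apply: (acts_by_eq (acts_by_comp (sE _ _) (tE _))
      (acts_by_comp (acts_by_autX 2 (tE _)) (sE _ _))) => a.
    exact: rot_codegen0.
- move=> h; split=> n i.
    apply: (acts_by_eq (acts_by_comp (dE _ _) (wE _ _))
      (acts_by_comp (wE _ _) (dE _ _))) => a.
    exact: (refl_coface tauM (omegaM h) (twist.1 h)).
  apply: (acts_by_eq (acts_by_comp (sE _ _) (wE _ _))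
    (acts_by_comp (wE _ _) (sE _ _))) => a.
  exact: (refl_codegen tau1 (omega1 h)).
- apply: (further_relations_tensor (tau := tau) (omega := fun h => omega h)) => //.
  + exact: hoch_tX1.
  + exact: hoch_w21.
  + exact: hoch_w41.
  + exact: hoch_w2tX.
  + by move=> h n; exact: hoch_dihedral.
Qed.

End HochschildData.

(** * The functor and its naturality *)

Section HochschildFunctor.
Variables (k : fieldType) (G : crossed_simplicial_group).
Variables (p : planar_type) (P : planar_presentation p G).

Lemma tw_actK (A : unital_algebra k) (rho : twisted_action G A) g :
  cancel (rho g^-1%g) (rho g).
Proof. by move=> a; rewrite -(tw_action rho).2 mulgV (tw_action rho).1. Qed.

Lemma tw_actVK (A : unital_algebra k) (rho : twisted_action G A) g :
  cancel (rho g) (rho g^-1%g).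
Proof. by move=> a; rewrite -(tw_action rho).2 mulVg (tw_action rho).1. Qed.

Section Object.
Variables (A : unital_algebra k) (rho : twisted_action G A).

Let omega_invK (h : has_reflection p) := @tw_actK A rho (pl_w P h 0).
Let omega_invVK (h : has_reflection p) := @tw_actVK A rho (pl_w P h 0).

Lemma op_tM a b : op_t P rho (a ** b) = op_t P rho a ** op_t P rho b.
Proof. by apply: tw_even; exact: even_t0V. Qed.

Lemma op_wM h a b : op_w P rho h (a ** b) = op_w P rho h b ** op_w P rho h a.
Proof. by apply: tw_odd; exact: odd_w0V. Qed.

Definition hochschild_simplicial := hoch_simplicial
  (tau := rho (pl_t P 0)^-1%g) (tw_one rho _) op_tM.

Definition hochschild_relations := hoch_relations
  (@tw_actK A rho (pl_t P 0)) (@tw_actVK A rho (pl_t P 0))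
  omega_invK omega_invVK (tw_one rho _) op_tM
  (fun h => tw_one rho (pl_w P h 0)^-1%g) op_wM (op_twist_relations P rho).

Definition hochschild_functor : functor (op G) (Vect k) (hochschild A) :=
  projT1 (cid (pl_complete P hochschild_relations)).

Lemma hochschild_functorP :
  [/\ restrict hochschild_functor = hochschild_simplicial,
      forall n, acts_by (hoch_map hochschild_functor (pl_t P n))
        (rotation_fun (op_t P rho))
    & forall h n, acts_by (hoch_map hochschild_functor (pl_w P h n))
        (reflection_fun (op_t P rho) (op_w P rho h))].
Proof.
rewrite /hochschild_functor; case: cid => F [[/= FS Ft Fw] _]; split=> // [n|h n].
- move: (Ft n) => /(congr1 (fun g : aut (Vect k) (hochschild A n) =>
    aut_val g : {linear hochschild A n -> hochschild A n})) /= FE a.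
  rewrite /hoch_map FE; exact: slotwise_mapE.
- move: (Fw h n) => /(congr1 (fun g : aut (Vect k) (hochschild A n) =>
    aut_val g : {linear hochschild A n -> hochschild A n})) /= FE a.
  rewrite /hoch_map FE; exact: slotwise_mapE.
Qed.

Lemma hochschild_functor_emb m n (phi : mor Delta m n) :
  acts_by (hoch_map hochschild_functor (fmap (csg_emb G) phi))
    (pull (op_t P rho) phi).
Proof.
have [FS _ _] := hochschild_functorP.
have FE := congr1 (fun S : functor (op Delta) (Vect k) (hochschild A) =>
  fmap S (phi : mor (op Delta) n m)
    : {linear hochschild A n -> hochschild A m}) FS.
move=> a; apply: etrans (congr1 (fun l : {linear hochschild A n -> hochschild A m} =>
  l (tensor a)) FE) _.
exact: slotwise_mapE.
Qed.

End Object.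

Lemma hoch_map_comp (A : unital_algebra k)
    (F : functor (op G) (Vect k) (hochschild A)) m n l
    (f : mor G n l) (g : mor G m n) x :
  hoch_map F (f \oc g) x = hoch_map F g (hoch_map F f x).
Proof.
by rewrite /hoch_map (fmap_comp F (g : mor (op G) n m) (f : mor (op G) l n)).
Qed.

Lemma hoch_map_id (A : unital_algebra k)
    (F : functor (op G) (Vect k) (hochschild A)) n x :
  hoch_map F (idm n) x = x.
Proof. by rewrite /hoch_map (fmap_id F). Qed.

Lemma hoch_map_autK (A : unital_algebra k)
    (F : functor (op G) (Vect k) (hochschild A)) n (g : aut G n) :
  cancel (hoch_map F (aut_val g)) (hoch_map F (aut_val g^-1%g)).
Proof. by move=> x; rewrite -hoch_map_comp [_ \oc _]aut_invK hoch_map_id. Qed.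

Lemma hoch_map_autVK (A : unital_algebra k)
    (F : functor (op G) (Vect k) (hochschild A)) n (g : aut G n) :
  cancel (hoch_map F (aut_val g^-1%g)) (hoch_map F (aut_val g)).
Proof. by move=> x; rewrite -hoch_map_comp [_ \oc _]aut_valK hoch_map_id. Qed.

(** Both sides reverse products, the left by contravariance and the right through the inverse, so
    the formula extends from the letters to all words. *)
Lemma hochschild_functor_zero (A : unital_algebra k) (rho : twisted_action G A)
    (g : aut G 0) (a : {ffun 'I_1 -> A}) :
  hoch_map (hochschild_functor rho) g (tensor a)
    = tensor [ffun i => rho g^-1%g (a i)].
Proof.
have [_ Ft Fw] := hochschild_functorP rho.
have inv_case (h : aut G 0) :
    (forall a : {ffun 'I_1 -> A}, hoch_map (hochschild_functor rho) h (tensor a)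
      = tensor [ffun i => rho h^-1%g (a i)]) ->
    forall a : {ffun 'I_1 -> A}, hoch_map (hochschild_functor rho) h^-1%g (tensor a)
      = tensor [ffun i => rho (h^-1)^-1%g (a i)].
  move=> IH b; apply: (can_inj (hoch_map_autK (hochschild_functor rho) h)).
  rewrite hoch_map_autVK IH; congr tensor; apply/ffunP => i.
  by rewrite !ffunE tw_actK.
have t_case b : hoch_map (hochschild_functor rho) (pl_t P 0) (tensor b)
    = tensor [ffun i => rho (pl_t P 0)^-1%g (b i)].
  rewrite Ft; congr tensor; apply/ffunP => i.
  by rewrite !ffunE [i]ord1 eqxx; congr (rho _ (b _)); exact: ord1.
have w_case h b : hoch_map (hochschild_functor rho) (pl_w P h 0) (tensor b)
    = tensor [ffun i => rho (pl_w P h 0)^-1%g (b i)].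
  by rewrite Fw; congr tensor; apply/ffunP => i; rewrite !ffunE [i]ord1 eqxx.
elim: (generated_aut0 P g) a => {g} [||| h | h | g g' _ IH _ IH'] a.
- rewrite [LHS]hoch_map_id; congr tensor; apply/ffunP => i.
  by rewrite ffunE invg1 (tw_action rho).1.
- exact: t_case.
- exact: inv_case t_case a.
- exact: w_case.
- exact: inv_case (w_case h) a.
- rewrite [LHS]hoch_map_comp IH IH'; congr tensor; apply/ffunP => i.
  by rewrite !ffunE invgM (tw_action rho).2.
Qed.

Lemma hochschild_functor_is_hochschild (A : unital_algebra k)
    (rho : twisted_action G A) :
  is_hochschild P rho (hochschild_functor rho).
Proof.
have [_ Ft Fw] := hochschild_functorP rho.
split.
- exact: hochschild_functor_zero.
- by move=> n i a; rewrite hochschild_functor_emb pull_coface.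
- by move=> n a; rewrite hochschild_functor_emb pull_last_coface.
- by move=> n i a; rewrite hochschild_functor_emb pull_codegen.
- exact: Ft.
- exact: Fw.
Qed.

(** * Naturality in the algebra *)

Section Naturality.
Variables (A B : unital_algebra k).
Variables (rho : twisted_action G A) (sigma : twisted_action G B).
Variable f : equivariant_alg_hom rho sigma.

Definition ffun_map n (a : {ffun 'I_n -> A}) : {ffun 'I_n -> B} :=
  [ffun i => f (a i)].

Lemma eah_op_t a : f (op_t P rho a) = op_t P sigma (f a).
Proof. exact: eah_act. Qed.

Lemma eah_op_w h a : f (op_w P rho h a) = op_w P sigma h (f a).
Proof. exact: eah_act. Qed.

Lemma ffun_map_pull m n (phi : mor Delta m n) (a : {ffun 'I_n.+1 -> A}) :
  ffun_map (pull (op_t P rho) phi a) = pull (op_t P sigma) phi (ffun_map a).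
Proof.
apply/ffunP => j; rewrite !ffunE (big_morph f (eah_mul f) (eah_one f)).
apply: eq_bigr => i _; rewrite /unroll_tuple !ffunE.
by case: ifP => // _; exact: eah_op_t.
Qed.

Lemma ffun_map_rotation n (a : {ffun 'I_n.+1 -> A}) :
  ffun_map (rotation_fun (op_t P rho) a) = rotation_fun (op_t P sigma) (ffun_map a).
Proof.
by apply/ffunP => j; rewrite !ffunE; case: ifP => // _; exact: eah_op_t.
Qed.

Lemma ffun_map_reflection h n (a : {ffun 'I_n.+1 -> A}) :
  ffun_map (reflection_fun (op_t P rho) (op_w P rho h) a)
    = reflection_fun (op_t P sigma) (op_w P sigma h) (ffun_map a).
Proof.
apply/ffunP => j; rewrite !ffunE.
by case: ifP => _; rewrite eah_op_w // eah_op_t.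
Qed.

Definition natural_at m n (g : mor G m n) : Prop := forall x,
  tensor_map f m.+1 (hoch_map (hochschild_functor rho) g x)
    = hoch_map (hochschild_functor sigma) g (tensor_map f n.+1 x).

Lemma natural_at_tensor m n (g : mor G m n) u v :
  acts_by (hoch_map (hochschild_functor rho) g) u ->
  acts_by (hoch_map (hochschild_functor sigma) g) v ->
  (forall a, ffun_map (u a) = v (ffun_map a)) -> natural_at g.
Proof.
move=> gu gv uv x.
have fE n' : acts_by (tensor_map f n') (@ffun_map n').
  by move=> a; rewrite tensor_mapE.
have E := acts_by_eq (acts_by_comp (fE _) gu) (acts_by_comp gv (fE _)) uv.
exact: (congr1 (fun l : {linear hochschild A n -> hochschild B m} => l x) E).
Qed.

Lemma natural_at_comp m n l (g : mor G n l) (g' : mor G m n) :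
  natural_at g -> natural_at g' -> natural_at (g \oc g').
Proof. by move=> Ng Ng' x; rewrite !hoch_map_comp Ng' Ng. Qed.

Lemma natural_at_inv n (g : aut G n) :
  natural_at (aut_val g) -> natural_at (aut_val g^-1%g).
Proof.
move=> Ng x; apply: (can_inj (hoch_map_autK (hochschild_functor sigma) g)).
by rewrite hoch_map_autVK -Ng hoch_map_autVK.
Qed.

Lemma natural_at_all m n (g : mor G m n) : natural_at g.
Proof.
have [_ At Aw] := hochschild_functorP rho.
have [_ Bt Bw] := hochschild_functorP sigma.
have Nt n' : natural_at (aut_val (pl_t P n')).
  exact: natural_at_tensor (At n') (Bt n') (@ffun_map_rotation n').
have Nw h n' : natural_at (aut_val (pl_w P h n')).
  exact: natural_at_tensor (Aw h n') (Bw h n') (@ffun_map_reflection h n').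
have [phi [g' [gen_g' ->]]] := gen_morP P g; apply: natural_at_comp.
  exact: natural_at_tensor (hochschild_functor_emb rho phi)
    (hochschild_functor_emb sigma phi) (ffun_map_pull phi).
elim: gen_g' => {g'} [||| h | h | g1 g2 _ IH1 _ IH2].
- by move=> x; rewrite !hoch_map_id.
- exact: Nt.
- exact: natural_at_inv.
- exact: Nw.
- by apply: natural_at_inv; exact: Nw.
- exact: natural_at_comp.
Qed.

End Naturality.

End HochschildFunctor.

Theorem theoremI37 (k : fieldType) (G : crossed_simplicial_group)
    (p : planar_type) (P : planar_presentation p G) :
  exists C : forall (A : unital_algebra k) (rho : twisted_action G A),
      functor (op G) (Vect k) (hochschild A),
    [/\ forall (A : unital_algebra k) (rho : twisted_action G A),
          is_hochschild P rho (C A rho),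
        forall (A B : unital_algebra k) (rho : twisted_action G A)
            (sigma : twisted_action G B) (f : equivariant_alg_hom rho sigma)
            (m n : nat) (phi : mor G m n) (x : hochschild A n),
          tensor_map f m.+1 (hoch_map (C A rho) phi x)
            = hoch_map (C B sigma) phi (tensor_map f n.+1 x)
      & forall (A : unital_algebra k) (rho : twisted_action G A) (n : nat),
          linear_action (fun g : aut G n => hoch_map (C A rho) (g^-1)%g)].
Proof.
exists (fun A rho => hochschild_functor P rho); split.
- exact: hochschild_functor_is_hochschild.
- by move=> A B rho sigma f m n phi x; exact: natural_at_all.
(* Contravariance alone gives a right action; the inverse turns it into a left one. *)
- move=> A rho n; split=> [x|g h x].
    by rewrite invg1; exact: hoch_map_id.
  by rewrite invgM; exact: hoch_map_comp.
Qed.
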